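(* For every integer $n\ge 1$, $$\langle f,g\rangle=\langle f,g\rangle_n=\langle f,g\rangle_n^*\qquad\text{for all } f,g\in\mathcal H_n .$$
   Context: Let $\mathbb R^4_H=\{\mathbf t\in\mathbb R^4: t_1+t_2+t_3+t_4=0\}$ with its 3-dimensional Lebesgue measure $d\mathbf t$, $\mathbb Z^4_H=\mathbb Z^4\cap\mathbb R^4_H$, $\Omega_H=\{\mathbf t\in\mathbb R^4_H: -1<t_i-t_j\le1,\ 1\le i<j\le 4\}$ (volume $2$), and $\langle f,g\rangle=\frac12\int_{\Omega_H}f\bar g\,d\mathbf t$. Let $\mathbb H=\{\mathbf k\in\mathbb Z^4_H: k_1\equiv k_2\equiv k_3\equiv k_4\pmod 4\}$ and $\phi_{\mathbf k}(\mathbf t)=e^{\frac{\pi i}{2}\mathbf k\cdot\mathbf t}$. Define $\mathbb H_n=\{\mathbf k\in\mathbb H: -4n<k_i-k_j\le 4n,\ 1\le i<j\le4\}$, $\mathbb H_n^*=\{\mathbf k\in\mathbb H: -4n\le k_i-k_j\le 4n,\ 1\le i<j\le 4\}$, and $\mathcal H_n=\operatorname{span}\{\phi_{\mathbf k}:\mathbf k\in\mathbb H_n\}$. For $\mathbf k\in\mathbb H_n^*$ define the weight $c^{(n)}_{\mathbf k}=1$ if $\max_i k_i-\min_i k_i<4n$, and otherwise (when $\max_ik_i-\min_ik_i=4n$) $c^{(n)}_{\mathbf k}=1/\binom{p+q}{p}$, where $p$ is the number of coordinates of $\mathbf k$ equal to $\max_ik_i$ and $q$ the number equal to $\min_i k_i$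 (so the weight is $1/2$ on faces, $1/3$ on edges, $1/4$ or $1/6$ at vertices). Define $\langle f,g\rangle_n=\frac{1}{4n^3}\sum_{\mathbf j\in\mathbb H_n}f(\tfrac{\mathbf j}{4n})\overline{g(\tfrac{\mathbf j}{4n})}$ and $\langle f,g\rangle_n^*=\frac1{4n^3}\sum_{\mathbf j\in\mathbb H_n^*}c^{(n)}_{\mathbf j}f(\tfrac{\mathbf j}{4n})\overline{g(\tfrac{\mathbf j}{4n})}$. *)

(* Defs.v *)
From HB Require Import structures.
From mathcomp Require Import all_boot all_order all_algebra.
From mathcomp Require Import all_classical all_reals all_analysis.
From mathcomp Require Import complex.
Set Implicit Arguments. Unset Strict Implicit. Unset Printing Implicit Defensive.
Import Order.TTheory GRing.Theory Num.Theory.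
Local Open Scope ring_scope.

Section Hex.
Variable R : realType.
Local Notation C := (complex R).

Definition pt4 := 'I_4 -> R.
Definition ivec := 'I_4 -> int.

Definition idot (k : ivec) (t : pt4) : R := \sum_(i < 4) (k i)%:~R * t i.

Definition phi (k : ivec) (t : pt4) : C :=
  Complex (cos (pi / 2 * idot k t)) (sin (pi / 2 * idot k t)).

Definition inH (k : ivec) : bool :=
  (\sum_(i < 4) k i == 0) && [forall i : 'I_4, forall j : 'I_4, (4 %| k i - k j)%Z].

Definition inHn (n : nat) (k : ivec) : bool :=
  inH k && [forall i : 'I_4, forall j : 'I_4,
    (i < j)%N ==> ((- (4 * n)%:Z < k i - k j) && (k i - k j <= (4 * n)%:Z))].
Definition inHn_star (n : nat) (k : ivec) : bool :=
  inH k && [forall i : 'I_4, forall j : 'I_4,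
    (i < j)%N ==> ((- (4 * n)%:Z <= k i - k j) && (k i - k j <= (4 * n)%:Z))].

(* explicit finite enumeration: every k in H_n^* has |k_i| <= 12 n *)
Definition box (n : nat) : seq int := [seq (i%:Z - (12 * n)%:Z) | i <- iota 0 (24 * n).+1].
Definition mk4 (a b c d : int) : ivec := fun i => nth 0 [:: a; b; c; d] i.
Definition allvecs (n : nat) : seq ivec :=
  flatten [seq flatten [seq [seq mk4 a b c d | d <- box n, c <- box n] | b <- box n] | a <- box n].
Definition Hn_seq (n : nat) : seq ivec := [seq k <- allvecs n | inHn n k].
Definition Hn_star_seq (n : nat) : seq ivec := [seq k <- allvecs n | inHn_star n k].

Definition in_calH (n : nat) (f : pt4 -> C) : Prop :=
  exists a : ivec -> C, forall t : pt4, f t = \sum_(k <- Hn_seq n) a k * phi k t.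

Definition kmax (k : ivec) : int := \big[Order.max/k ord0]_(i < 4) k i.
Definition kmin (k : ivec) : int := \big[Order.min/k ord0]_(i < 4) k i.
Definition cweight (n : nat) (k : ivec) : C :=
  if kmax k - kmin k < (4 * n)%:Z then 1
  else let p := #|[set i : 'I_4 | k i == kmax k]| in
       let q := #|[set i : 'I_4 | k i == kmin k]| in
       ('C(p + q, p)%:R)^-1.

Definition scale_pt (n : nat) (j : ivec) : pt4 := fun i => (j i)%:~R / (4 * n)%:R.

Definition ip_n (n : nat) (f g : pt4 -> C) : C :=
  ((4 * n ^ 3)%:R)^-1 *
  \sum_(j <- Hn_seq n) f (scale_pt n j) * conjc (g (scale_pt n j)).
Definition ip_n_star (n : nat) (f g : pt4 -> C) : C :=
  ((4 * n ^ 3)%:R)^-1 *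
  \sum_(j <- Hn_star_seq n) cweight n j * f (scale_pt n j) * conjc (g (scale_pt n j)).

(* The hyperplane R^4_H is parametrised by (x1,x2,x3) |-> (x1,x2,x3,-x1-x2-x3);
   the 3-dimensional Lebesgue (surface) measure on R^4_H is 2 times the image of
   Lebesgue measure on R^3 (Gram determinant sqrt(det(J^T J)) = sqrt 4 = 2). *)
Definition mk4R (a b c d : R) : pt4 := fun i => nth 0 [:: a; b; c; d] i.
Definition embedH (x : R * R * R) : pt4 :=
  mk4R x.1.1 x.1.2 x.2 (- x.1.1 - x.1.2 - x.2).

Definition OmegaH : set (R * R * R) :=
  [set x | forall i j : 'I_4, (i < j)%N ->
     (-1 < embedH x i - embedH x j) /\ (embedH x i - embedH x j <= 1)].

Definition leb3 := ((@lebesgue_measure R \x @lebesgue_measure R) \x @lebesgue_measure R)%E.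

(* integral of a complex-valued function over D w.r.t. the surface measure dt on R^4_H *)
Definition intH (D : set (R * R * R)) (F : pt4 -> C) : C :=
  (2%:R : C) * Complex (Rintegral leb3 D (fun x => complex.Re (F (embedH x))))
                   (Rintegral leb3 D (fun x => complex.Im (F (embedH x)))).

Definition ip (f g : pt4 -> C) : C :=
  (2%:R)^-1 * intH OmegaH (fun t => f t * conjc (g t)).

End Hex.

(* Main.v *)
(** The half-open set OmegaH is a fundamental domain of R^4_H for the translations by
    Z^4_H, and likewise H_n is a set of representatives of H / 4n Z^4_H, a group with 4n^3
    elements.  The sum over H_n and the integral over OmegaH of a Z^4_H-periodic
    function are therefore translation invariant; since a translation multiplies the
    character phi_(k-l) by a constant, both vanish on it as soon as some translation makes
    the constant different from 1, i.e. whenever k <> l in H_n.  (For the integral one picks a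
    translation with constant -1.)  So both inner products make the phi_k orthonormal.
    A class modulo 4n Z^4_H meets H_n^* either in one interior point, or in the C(p+q, p)
    boundary points that place the maximal value on p of the p+q extremal coordinates and the
    minimal value on the others; the weights add up to 1 over each class. *)

Require Import Defs.
From HB Require Import structures.
From mathcomp Require Import all_boot all_order all_algebra.
From mathcomp Require Import all_classical all_reals all_analysis.
From mathcomp Require Import complex.
From mathcomp Require Import measurable_realfun.
From mathcomp Require Import zify ring lra.
Import Order.TTheory GRing.Theory Num.Theory.
Local Open Scope ring_scope.

(** * The half-open window on four coordinates *)

Definition window {K : realDomainType} (N : K) (t : 'I_4 -> K) : Prop :=
  forall i j : 'I_4, (i < j)%N -> - N < t i - t j /\ t i - t j <= N.

Definition closed_window {K : realDomainType} (N : K) (t : 'I_4 -> K) : Prop :=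
  forall i j : 'I_4, t i - t j <= N.

Lemma window_closed {K : realDomainType} (N : K) (t : 'I_4 -> K) :
  0 <= N -> window N t -> closed_window N t.
Proof.
move=> N0 wt i j; case: (ltngtP i j) => [ij|ji|/val_inj ->].
- by have [] := wt _ _ ij.
- by have [h _] := wt _ _ ji; lra.
- by rewrite subrr.
Qed.

(* [window N t] says that (t i, i) precedes (t j + N, j) lexicographically for i <> j, so it
   survives lowering the lexicographically largest coordinate by N. *)
Lemma window_step {K : realDomainType} (N : K) (t : 'I_4 -> K) :
  0 < N -> window N t ->
  exists a, window N (fun i => t i - N * (i == a)%:R).
Proof.
move=> N0 wt.
have cw := window_closed _ _ (ltW N0) wt.
pose a1 := [arg max_(a > ord0) t a]%O.
have max1 i : t i <= t a1 by rewrite /a1; case: arg_maxP => // k _ h; exact: h.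
pose a := [arg max_(a > a1 | t a == t a1) (a : nat)]%N.
have [ta maxa] : t a = t a1 /\ forall i, t i = t a1 -> (i <= a)%N.
  by rewrite /a; case: arg_maxnP => [//|k /eqP tk h]; split=> // i /eqP /h.
exists a => i j ij.
have [ia|ia] := eqVneq i a; have [ja|ja] := eqVneq j a => /=.
- by move: ij; rewrite ia ja ltnn.
- have tj : t j < t a.
    rewrite lt_neqAle {2}ta max1 andbT; apply/eqP => tj.
    by have := maxa j; rewrite tj ta => /(_ erefl); rewrite leqNgt -ia ij.
  by have := cw a j; rewrite ia; lra.
- by have [] := wt _ _ ij; have := max1 i; rewrite -ta ja; lra.
- by have [] := wt _ _ ij; lra.
Qed.

Lemma sum0_signs (m : 'I_4 -> int) i : \sum_i m i = 0 -> m i != 0 ->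
  exists a b, 0 < m a /\ m b < 0.
Proof.
move=> sm mi.
have [a ma] : exists a, 0 < m a.
  apply/existsP; apply: contraT; rewrite negb_exists => /forallP h.
  have /eqP := sm; rewrite -oppr_eq0 -sumrN psumr_eq0 => [/allP/(_ i)|k _].
    by rewrite mem_index_enum /= oppr_eq0 (negPf mi) => /(_ isT).
  by have := h k; lia.
have [b mb] : exists b, m b < 0.
  apply/existsP; apply: contraT; rewrite negb_exists => /forallP h.
  have /eqP := sm; rewrite psumr_eq0 => [/allP/(_ i)|k _].
    by rewrite mem_index_enum /= (negPf mi) => /(_ isT).
  by have := h k; lia.
by exists a, b.
Qed.

(** Closedness of the shifted point gives [t a - t b >= N * (m a - m b) - N], which is at least [N]
    since [m a >= 1] and [m b <= -1]. Closedness of [t] bounds the same difference by [N], so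
    equality holds throughout. This rigidity serves both the uniqueness in the half-open window and
    the description of the boundary classes. *)
Lemma closed_window_extremes {K : realDomainType} (N : K) (t : 'I_4 -> K) (m : 'I_4 -> int) :
  0 < N -> closed_window N t -> closed_window N (fun i => t i - N * (m i)%:~R) ->
  forall a b, 0 < m a -> m b < 0 -> [/\ t a - t b = N, m a = 1 & m b = -1].
Proof.
move=> N0 wt wt' a b ma mb.
have := wt a b; have := wt' b a => /= hba hab.
have e1 : (m a)%:~R = 1 + (m a - 1)%:~R :> K by rewrite rmorphB /=; ring.
have e2 : (m b)%:~R = - 1 - (- 1 - m b)%:~R :> K by rewrite rmorphB /= rmorphN /=; ring.
have p1 : 0 <= N * (m a - 1)%:~R by rewrite (mulr_ge0 (ltW N0)) // ler0z; lia.
have p2 : 0 <= N * (-1 - m b)%:~R by rewrite (mulr_ge0 (ltW N0)) // ler0z; lia.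
rewrite e1 e2 in hba.
have z1 : N * (m a - 1)%:~R = 0 by lra.
have z2 : N * (-1 - m b)%:~R = 0 by lra.
split; first by lra.
- by move/eqP: z1; rewrite mulf_eq0 gt_eqF //= intr_eq0; lia.
- by move/eqP: z2; rewrite mulf_eq0 gt_eqF //= intr_eq0; lia.
Qed.

(** A nonzero [m] would give [a], [b] whose difference is [N] in [t] and [-N] after the shift. The
    strict lower bound, imposed only for the smaller index first, fails for the shifted point if a <
    b and for [t] if b < a. *)
Lemma window_unique {K : realDomainType} (N : K) (t : 'I_4 -> K) (m : 'I_4 -> int) :
  0 < N -> \sum_i m i = 0 -> window N t -> window N (fun i => t i - N * (m i)%:~R) ->
  forall i, m i = 0.
Proof.
move=> N0 sm wt wt' i; apply/eqP/negPn/negP => mi.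
have [a [b [ma mb]]] := sum0_signs _ _ sm mi.
have [tab m1 m2] := closed_window_extremes _ _ _ N0 (window_closed _ _ (ltW N0) wt)
  (window_closed _ _ (ltW N0) wt') _ _ ma mb.
case: (ltngtP a b) => [ab|ba|/val_inj ab].
- have [] := wt' _ _ ab; rewrite m1 m2 rmorphN1 rmorph1 /=; lra.
- have [] := wt _ _ ba; lra.
- by move: mb; rewrite -ab; lia.
Qed.

(* The remainders [t i - N * m0 i] form a window with sum d * N for some d >= 0; [window_step]
   is applied d times. *)
Lemma window_exists {K : realDomainType} (N : K) (t : 'I_4 -> K) (m0 : 'I_4 -> int) :
  0 < N -> \sum_i t i = 0 -> (forall i, 0 <= t i - N * (m0 i)%:~R < N) ->
  exists m : 'I_4 -> int, \sum_i m i = 0 /\ window N (fun i => t i - N * (m i)%:~R).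
Proof.
move=> N0 st fl.
have sm0 : \sum_i m0 i <= 0.
  have : 0 <= \sum_i (t i - N * (m0 i)%:~R) by apply: sumr_ge0 => i _; have /andP[] := fl i.
  rewrite big_split /= st add0r sumrN -mulr_sumr -rmorph_sum /= oppr_ge0.
  by rewrite pmulr_rle0 // lerz0.
have w0 : window N (fun i => t i - N * (m0 i)%:~R).
  move=> i j _; have /andP[? ?] := fl i; have /andP[? ?] := fl j; lra.
have [d hd] : exists d : nat, \sum_i m0 i = - d%:Z by exists (absz (\sum_i m0 i)); lia.
clear fl sm0 st; elim: d m0 hd w0 => [|d IH] m hm wm; first by exists m.
have [a wa] := window_step _ _ N0 wm.
apply: (IH (fun i => m i + (i == a)%:R)).
  rewrite big_split /= hm; have -> : \sum_i (i == a)%:R = 1 :> int; last by lia.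
  by rewrite (bigD1 a) //= eqxx big1 ?addr0 // => i /negPf ->.
move=> i j ij; have := wa i j ij.
by rewrite !rmorphD /= !rmorph_nat !mulrDr !opprD !addrA.
Qed.

(** * The index sets H_n and H_n^* *)

Lemma inHP (k : ivec) :
  reflect (\sum_i k i = 0 /\ forall i j, (4 %| k i - k j)%Z) (inH k).
Proof.
apply: (iffP andP) => [[/eqP sk /forallP h]|[sk h]]; split=> //; last 2 first.
- exact/eqP.
- by apply/forallP => i; apply/forallP => j.
- by move=> i j; have /forallP := h i.
Qed.

Lemma inHnP (n : nat) (k : ivec) :
  reflect (inH k /\ window (4 * n)%:Z k) (inHn n k).
Proof.
apply: (iffP andP) => [[hk /forallP h]|[hk h]]; split=> //.
  by move=> i j ij; have /forallP/(_ j) := h i; rewrite ij => /andP.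
apply/forallP => i; apply/forallP => j; apply/implyP => /h [-> ->] //.
Qed.

Lemma inHn_starP (n : nat) (k : ivec) :
  reflect (inH k /\ closed_window (4 * n)%:Z k) (inHn_star n k).
Proof.
apply: (iffP andP) => [[hk /forallP h]|[hk h]]; split=> //.
  move=> i j; case: (ltngtP i j) => [ij|ji|/val_inj ->]; last by rewrite subrr.
  - by have /forallP/(_ j) := h i; rewrite ij => /andP[].
  - by have /forallP/(_ i) := h j; rewrite ji => /andP[]; lia.
apply/forallP => i; apply/forallP => j; apply/implyP => _.
by have := h i j; have := h j i; lia.
Qed.

(** The map [g] reads the index of a block back from its entries, so distinct blocks are
    disjoint. *)
Lemma uniq_flatten_map (A : eqType) (T : eqType) (F : A -> seq T) (g : T -> A) (s : seq A) :
  uniq s -> (forall a, uniq (F a)) -> (forall a x, x \in F a -> g x = a) ->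
  uniq (flatten [seq F a | a <- s]).
Proof.
move=> + uF gF; elim: s => //= a s IH /andP[as_ us].
rewrite cat_uniq uF IH // andbT /=; apply/hasPn => x /flatten_mapP[b bs xb].
by apply/negP => /gF xa; move: as_; rewrite -xa (gF _ _ xb) bs.
Qed.

Lemma ivec_mk4 (k : ivec) :
  k = mk4 (k (inord 0)) (k (inord 1)) (k (inord 2)) (k (inord 3)).
Proof.
apply: funext => i; rewrite -{1}(inord_val i) /mk4.
by move: (ltn_ord i); case: (nat_of_ord i) => [|[|[|[|m]]]].
Qed.

Lemma uniq_allvecs (n : nat) : uniq (allvecs n).
Proof.
have ub : uniq (box n).
  by rewrite map_inj_uniq ?iota_uniq // => i j /=; lia.
apply: (uniq_flatten_map _ _ _ (fun k => k (inord 0))) => // [a|a k]; last first.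
  by move=> /flatten_mapP[b _ /allpairsP[[d c] /= [_ _ ->]]]; rewrite /mk4 inordK.
apply: (uniq_flatten_map _ _ _ (fun k => k (inord 1))) => // [b|b k]; last first.
  by move=> /allpairsP[[d c] /= [_ _ ->]]; rewrite /mk4 inordK.
apply: allpairs_uniq => // -[d c] [d' c'] _ _ /= h; congr (_, _).
- by have := congr1 (@^~ (inord 3)) h; rewrite /mk4 /= inordK.
- by have := congr1 (@^~ (inord 2)) h; rewrite /mk4 /= inordK.
Qed.

Lemma mem_box (n : nat) (x : int) : (x \in box n) = (- (12 * n)%:Z <= x <= (12 * n)%:Z).
Proof.
apply/mapP/idP => [[x0]|h]; first by rewrite mem_iota; lia.
by exists (absz (x + (12 * n)%:Z)); rewrite ?mem_iota; lia.
Qed.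

Lemma mem_allvecs (n : nat) (k : ivec) :
  \sum_i k i = 0 -> closed_window (4 * n)%:Z k -> k \in allvecs n.
Proof.
move=> sk ck.
(* As [k] sums to 0, 4 k_i is the sum over j of k_i - k_j; hence |k_i| <= 4n, inside the box. *)
have kb i : k i \in box n.
  have : \sum_j (k i - k j) <= \sum_(j < 4) (4 * n)%:Z by apply: ler_sum => j _; exact: ck.
  have : \sum_j (k j - k i) <= \sum_(j < 4) (4 * n)%:Z by apply: ler_sum => j _; exact: ck.
  rewrite !sumrB sk !sumr_const !card_ord mem_box; lia.
rewrite (ivec_mk4 k) /allvecs.
apply/flatten_mapP; exists (k (inord 0)) => //.
apply/flatten_mapP; exists (k (inord 1)) => //.
exact: (allpairs_f (fun d c => mk4 (k (inord 0)) (k (inord 1)) c d)).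
Qed.

Lemma mem_Hn (n : nat) (k : ivec) : (k \in Hn_seq n) = inHn n k.
Proof.
rewrite mem_filter; apply: andb_idr => /inHnP[/inHP[sk _] wk].
by apply: mem_allvecs => //; apply: window_closed.
Qed.

Lemma mem_Hn_star (n : nat) (k : ivec) : (k \in Hn_star_seq n) = inHn_star n k.
Proof.
by rewrite mem_filter; apply: andb_idr => /inHn_starP[/inHP[sk _] ck]; apply: mem_allvecs.
Qed.

Lemma uniq_Hn (n : nat) : uniq (Hn_seq n).
Proof. exact/filter_uniq/uniq_allvecs. Qed.

Lemma uniq_Hn_star (n : nat) : uniq (Hn_star_seq n).
Proof. exact/filter_uniq/uniq_allvecs. Qed.

(** * Congruence modulo 4n Z^4_H and its representatives in H_n *)

Definition cong (n : nat) (j k : ivec) : bool :=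
  [forall i, ((4 * n)%:Z %| j i - k i)%Z].

(** Coordinatewise divisibility suffices: the quotients sum to 0 because 4n times their sum is the
    difference of two zero sums. *)
Lemma congP (n : nat) (j k : ivec) : (0 < n)%N -> \sum_i j i = 0 -> \sum_i k i = 0 ->
  reflect (exists m : 'I_4 -> int, \sum_i m i = 0 /\ k = (fun i => j i - (4 * n)%:Z * m i))
          (cong n j k).
Proof.
move=> n0 sj sk; apply: (iffP forallP) => [h|[m [sm ->]] i]; last first.
  by rewrite opprD addrA subrr sub0r opprK; apply: dvdz_mulr.
exists (fun i => ((j i - k i) %/ (4 * n)%:Z)%Z).
have e i : (4 * n)%:Z * ((j i - k i) %/ (4 * n)%:Z)%Z = j i - k i.
  by rewrite mulrC divzK.
split; last by apply: funext => i; rewrite e; ring.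
have : (4 * n)%:Z * \sum_i ((j i - k i) %/ (4 * n)%:Z)%Z = 0.
  by rewrite mulr_sumr (eq_bigr _ (fun i _ => e i)) sumrB sj sk subrr.
by move/eqP; rewrite mulf_eq0 => /orP[|/eqP //]; lia.
Qed.

Lemma cong_sym (n : nat) (j k : ivec) : cong n j k = cong n k j.
Proof. by apply: eq_forallb => i; rewrite -rpredN opprB. Qed.

Lemma cong_trans (n : nat) (j k l : ivec) : cong n j k -> cong n k l -> cong n j l.
Proof.
move=> /forallP h /forallP h'; apply/forallP => i.
by have := rpredD (h i) (h' i); rewrite addrA subrK.
Qed.

Lemma inH_cong (n : nat) (j k : ivec) : \sum_i k i = 0 -> cong n j k -> inH j -> inH k.
Proof.
move=> sk /forallP h /inHP[_ hj]; apply/inHP; split=> // a b.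
have h4 i : (4 %| j i - k i)%Z by apply: dvdz_trans (h i); rewrite PoszM dvdz_mulr.
have -> : k a - k b = (j a - j b) - (j a - k a) + (j b - k b) by ring.
exact: (rpredD (rpredB (hj _ _) (h4 _)) (h4 _)).
Qed.

Lemma cong_Hn_inj (n : nat) (j k : ivec) : (0 < n)%N ->
  inHn n j -> inHn n k -> cong n j k -> j = k.
Proof.
move=> n0 /inHnP[/inHP[sj _] wj] /inHnP[/inHP[sk _] wk] /congP[] // m [sm ek].
have N0 : 0 < (4 * n)%:Z by lia.
have m0 : forall i, m i = 0.
  apply: (window_unique _ _ _ N0 sm wj) => i i' /wk; rewrite ek.
  by rewrite !intz.
by apply: funext => i; rewrite ek m0 mulr0 subr0.
Qed.

Lemma cong_Hn_exists (n : nat) (j : ivec) : (0 < n)%N -> inH j ->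
  exists2 k, inHn n k & cong n j k.
Proof.
move=> n0 hj; have [sj _] := inHP _ hj.
have N0 : 0 < (4 * n)%:Z by lia.
(* Euclidean division by 4n supplies the remainders from which [window_exists] starts. *)
have [|m [sm wm]] := window_exists _ j (fun i => (j i %/ (4 * n)%:Z)%Z) N0 sj.
  move=> i; rewrite intz mulrC.
  have -> : j i - (j i %/ (4 * n)%:Z)%Z * (4 * n)%:Z = (j i %% (4 * n)%:Z)%Z.
    by rewrite {1}(divz_eq (j i) (4 * n)%:Z); ring.
  by rewrite modz_ge0 ?ltz_pmod //; lia.
have sk : \sum_i (j i - (4 * n)%:Z * m i) = 0 by rewrite sumrB -mulr_sumr sj sm; ring.
have cjk : cong n j (fun i => j i - (4 * n)%:Z * m i) by apply/congP => //; exists m.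
exists (fun i => j i - (4 * n)%:Z * m i) => //.
apply/inHnP; split; first exact: inH_cong cjk hj.
by move=> a b /wm; rewrite !intz.
Qed.

(** * Comparison of sums over classes *)

Lemma sum_unique (V : nmodType) (T : eqType) (s : seq T) (E : pred T) (v : T -> V) x :
  uniq s -> x \in s -> E x -> (forall y, y \in s -> E y -> y = x) ->
  \sum_(y <- s | E y) v y = v x.
Proof.
move=> us xs Ex h; rewrite big_mkcond (bigD1_seq x) //= Ex big_seq_cond big1 ?addr0 // => y.
by case/andP=> ys yx; case: ifP => // /(h _ ys) /eqP; rewrite (negPf yx).
Qed.

(* Both sides equal the double sum of [u x * v y * F x] over the pairs related by [E]. *)
Lemma transport_sum (K : comPzRingType) (S T : eqType) (s : seq S) (t : seq T)
    (u F : S -> K) (v G : T -> K) (E : S -> T -> bool) :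
  (forall x, x \in s -> \sum_(y <- t | E x y) v y = 1) ->
  (forall y, y \in t -> \sum_(x <- s | E x y) u x = 1) ->
  (forall x y, x \in s -> y \in t -> E x y -> F x = G y) ->
  \sum_(x <- s) u x * F x = \sum_(y <- t) v y * G y.
Proof.
move=> hs ht FG.
transitivity (\sum_(x <- s) \sum_(y <- t | E x y) u x * v y * F x).
  rewrite big_seq [RHS]big_seq; apply: eq_bigr => x /hs e.
  by rewrite -mulr_suml -mulr_sumr e mulr1.
rewrite (exchange_big_dep xpredT) //= big_seq [RHS]big_seq.
apply: eq_bigr => y yt; rewrite -[RHS]mul1r -(ht y yt) mulr_suml.
rewrite big_seq_cond [RHS]big_seq_cond; apply: eq_bigr => x /andP[xs Exy].
by rewrite (FG x y) // mulrA.
Qed.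

(** A translation by [h] need not map H_n to itself, but it permutes the classes that H_n
    represents. The sums are transported with unit weights along the relation [j + h] congruent to
    [k]. *)
Lemma sum_Hn_shift (K : comPzRingType) (n : nat) (h : ivec) (F : ivec -> K) :
  (0 < n)%N -> inH h ->
  (forall j k, inH j -> inH k -> cong n j k -> F j = F k) ->
  \sum_(j <- Hn_seq n) F (fun i => j i + h i) = \sum_(j <- Hn_seq n) F j.
Proof.
move=> n0 hh FF.
have HD (x y : ivec) : inH x -> inH y -> inH (fun i => x i + y i).
  move=> /inHP[sx dx] /inHP[sy dy]; apply/inHP; split=> [|a b].
    by rewrite big_split /= sx sy addr0.
  have -> : x a + y a - (x b + y b) = (x a - x b) + (y a - y b) by ring.
  exact: (rpredD (dx _ _) (dy _ _)).
have HN (x : ivec) : inH x -> inH (fun i => - x i).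
  move=> /inHP[sx dx]; apply/inHP; split=> [|a b]; first by rewrite sumrN sx oppr0.
  by rewrite opprK addrC.
have e := transport_sum K _ _ (Hn_seq n) (Hn_seq n) (fun=> 1) (fun j => F (fun i => j i + h i))
  (fun=> 1) F (fun j k => cong n (fun i => j i + h i) k).
rewrite (eq_bigr (fun j => 1 * F (fun i => j i + h i))) => [|j _]; last by rewrite mul1r.
rewrite e; first by apply: eq_bigr => j _; rewrite mul1r.
- move=> j; rewrite mem_Hn => /[dup] jn /inHnP[jH _].
  have [k kn ck] := cong_Hn_exists n _ n0 (HD _ _ jH hh).
  rewrite (sum_unique _ _ _ _ _ k) ?uniq_Hn ?mem_Hn // => y; rewrite mem_Hn => yn cy.
  by apply: (cong_Hn_inj n) => //; apply: cong_trans ck; rewrite cong_sym.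
- move=> k; rewrite mem_Hn => /[dup] kn /inHnP[kH _].
  have [j jn cj] := cong_Hn_exists n _ n0 (HD _ _ kH (HN _ hh)).
  have ce (x : ivec) : cong n (fun i => x i + h i) k = cong n x (fun i => k i - h i).
    by apply: eq_forallb => i; congr (dvdz _ _); ring.
  rewrite (sum_unique _ _ _ _ _ j) ?uniq_Hn ?mem_Hn // ?ce 1?cong_sym // => y.
  rewrite mem_Hn ce => yn cy.
  by apply: (cong_Hn_inj n) => //; apply: cong_trans cj.
- by move=> j k; rewrite !mem_Hn => /inHnP[jH _] /inHnP[kH _]; apply: FF => //; apply: HD.
Qed.

(** * The cardinality of H_n *)

Lemma all4 (P : 'I_4 -> Prop) :
  P (inord 0) -> P (inord 1) -> P (inord 2) -> P (inord 3) -> forall i, P i.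
Proof.
move=> h0 h1 h2 h3 i; rewrite -(inord_val i).
by move: (ltn_ord i); case: (nat_of_ord i) => [|[|[|[|m]]]].
Qed.

Lemma sum4 (V : nmodType) (f : 'I_4 -> V) :
  \sum_i f i = f (inord 0) + f (inord 1) + f (inord 2) + f (inord 3).
Proof.
rewrite !big_ord_recl big_ord0 addr0 !addrA.
by do !congr (_ + _); congr f; apply: val_inj; rewrite /= inordK.
Qed.

Lemma mk4E (a b c d : int) : (mk4 a b c d (inord 0) = a) * (mk4 a b c d (inord 1) = b) *
  (mk4 a b c d (inord 2) = c) * (mk4 a b c d (inord 3) = d).
Proof. by rewrite /mk4 !inordK. Qed.

Lemma modz_eq_small (N x y : int) : 0 <= x < N -> 0 <= y < N -> (N %| x - y)%Z -> x = y.
Proof. by move=> hx hy; rewrite -eqz_mod_dvd !modz_small // => /eqP. Qed.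

(** Both numbers lie in [0, 4n), so congruence modulo 4n is equality; [a] and [u] are then the
    remainder and the quotient by 4. *)
Lemma digits_inj (n a u a' u' : nat) :
  (a < 4)%N -> (a' < 4)%N -> (u < n)%N -> (u' < n)%N ->
  ((4 * n)%:Z %| (a + 4 * u)%N%:Z - (a' + 4 * u')%N%:Z)%Z -> a = a' /\ u = u'.
Proof.
move=> ha ha' hu hu'.
have b : 0 <= (a + 4 * u)%N%:Z < (4 * n)%:Z by lia.
have b' : 0 <= (a' + 4 * u')%N%:Z < (4 * n)%:Z by lia.
by move=> /(modz_eq_small _ _ _ b b'); lia.
Qed.

(* Representatives of the classes: the first three coordinates of a vector of H modulo 4n are
   a + 4u, a + 4v, a + 4w with a common a < 4, and they determine the class. *)
Definition cell_vec (n : nat) (p : 'I_4 * ('I_n * ('I_n * 'I_n))) : ivec :=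
  let: (a, (u, (v, w))) := p in
  mk4 (a + 4 * u)%N%:Z (a + 4 * v)%N%:Z (a + 4 * w)%N%:Z
      (- (3 * a + 4 * u + 4 * v + 4 * w)%N%:Z).

Lemma inH_cell_vec (n : nat) p : inH (cell_vec n p).
Proof.
case: p => a [u [v w]]; apply/inHP; split; first by rewrite sum4 /cell_vec !mk4E; lia.
by apply: all4; apply: all4; rewrite /cell_vec !mk4E; lia.
Qed.

Lemma cong_cell_vec_inj (n : nat) p q : cong n (cell_vec n p) (cell_vec n q) -> p = q.
Proof.
case: p q => a [u [v w]] [a' [u' [v' w']]] /forallP h.
have := h (inord 0); have := h (inord 1); have := h (inord 2).
rewrite /cell_vec !mk4E => h2 h1 h0.
have [ea eu] := digits_inj _ _ _ _ _ (ltn_ord _) (ltn_ord _) (ltn_ord _) (ltn_ord _) h0.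
have [_ ev] := digits_inj _ _ _ _ _ (ltn_ord _) (ltn_ord _) (ltn_ord _) (ltn_ord _) h1.
have [_ ew] := digits_inj _ _ _ _ _ (ltn_ord _) (ltn_ord _) (ltn_ord _) (ltn_ord _) h2.
by congr (_, (_, (_, _))); apply: val_inj.
Qed.

Lemma cong_cell_vec_exists (n : nat) (k : ivec) : (0 < n)%N -> inH k ->
  exists p, cong n k (cell_vec n p).
Proof.
move=> n0 /inHP[sk dk].
pose r i := absz (k i %% (4 * n)%:Z)%Z.
have N0 : (4 * n)%:Z != 0 by lia.
have rE i : (r i)%:Z = (k i %% (4 * n)%:Z)%Z by rewrite /r gez0_abs ?modz_ge0.
have r_lt i : (r i %/ 4 < n)%N.
  by rewrite ltn_divLR // mulnC -ltz_nat rE ltz_pmod //; lia.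
have rdvd i : ((4 * n)%:Z %| k i - (r i)%:Z)%Z.
  by rewrite rE -eqz_mod_dvd modz_mod.
(* The coordinates of [k] agree modulo 4 and 4 divides 4n, so the remainders [r i] share their last
   digit in base 4; this digit is the parameter a of the cell. *)
have r4 i : (r i %% 4 = r (inord 0) %% 4)%N.
  have h j : (4 %| k j - (r j)%:Z)%Z by apply: dvdz_trans (rdvd j); rewrite PoszM dvdz_mulr.
  by have := h i; have := h (inord 0); have := dk i (inord 0); lia.
exists (inord (r (inord 0) %% 4), (Ordinal (r_lt (inord 0)),
         (Ordinal (r_lt (inord 1)), Ordinal (r_lt (inord 2))))).
have e i : (r (inord 0) %% 4 + 4 * (r i %/ 4))%N = r i by have := r4 i; lia.
rewrite /cell_vec /= (@inordK 3 (_ %% 4)) ?ltn_pmod //.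
have -> : (3 * (r (inord 0) %% 4) + 4 * (r (inord 0) %/ 4) + 4 * (r (inord 1) %/ 4)
   + 4 * (r (inord 2) %/ 4) = r (inord 0) + r (inord 1) + r (inord 2))%N.
  by have := e (inord 0); have := e (inord 1); have := e (inord 2); lia.
rewrite !e; apply/forallP; apply: all4; rewrite !mk4E //.
(* The fourth coordinate needs no separate digits: both vectors sum to 0, so its congruence follows
   from the other three. *)
have -> : k (inord 3) - - (r (inord 0) + r (inord 1) + r (inord 2))%N%:Z =
  - ((k (inord 0) - (r (inord 0))%:Z) + (k (inord 1) - (r (inord 1))%:Z) +
     (k (inord 2) - (r (inord 2))%:Z)).
  by move: sk; rewrite sum4; lia.
by rewrite rpredN (rpredD (rpredD (rdvd _) (rdvd _))).
Qed.

(** Transport of the constant 1 along congruence counts H_n by the parameters of [cell_vec]: 4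
    values of a and n values each of u, v, w. *)
Lemma size_Hn (n : nat) : (0 < n)%N -> size (Hn_seq n) = (4 * n ^ 3)%N.
Proof.
move=> n0.
have sz (T : eqType) (s : seq T) : \sum_(x <- s) 1 * 1 = (size s)%:Z.
  by elim: s => [|x s IH]; rewrite ?big_nil // big_cons IH mulr1 /=; lia.
have e := transport_sum int _ _ (Hn_seq n) (enum {: 'I_4 * ('I_n * ('I_n * 'I_n))})
  (fun=> 1) (fun=> 1) (fun=> 1) (fun=> 1) (fun k p => cong n k (cell_vec n p)).
suff : (size (Hn_seq n))%:Z = (size (enum {: 'I_4 * ('I_n * ('I_n * 'I_n))}))%:Z.
  by case=> ->; rewrite -cardE !card_prod !card_ord; ring.
rewrite -!sz; apply: e => // [k|p _].
  rewrite mem_Hn => /inHnP[kH _]; have [p cp] := cong_cell_vec_exists _ _ n0 kH.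
  rewrite (sum_unique _ _ _ _ _ p) ?enum_uniq ?mem_enum // => q _ cq.
  by apply: cong_cell_vec_inj; apply: cong_trans cp; rewrite cong_sym.
have [k kn ck] := cong_Hn_exists n _ n0 (inH_cell_vec n p).
rewrite (sum_unique _ _ _ _ _ k) ?uniq_Hn ?mem_Hn 1?cong_sym // => y.
by rewrite mem_Hn => yn cy; apply: (cong_Hn_inj n) => //; apply: cong_trans ck.
Qed.

(** * The weights of H_n^* *)

Lemma kmax_ge (k : ivec) i : k i <= kmax k.
Proof. exact: le_bigmax. Qed.

Lemma kmin_le (k : ivec) i : kmin k <= k i.
Proof. exact: bigmin_le. Qed.

Lemma kmax_attained (k : ivec) : exists i, k i = kmax k.
Proof.
rewrite /kmax; elim/big_ind: _ => [|_ _ [i <-] [j <-]|i _]; first by exists ord0.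
- by case: leP => _; [exists j|exists i].
- by exists i.
Qed.

Lemma kmin_attained (k : ivec) : exists i, k i = kmin k.
Proof.
rewrite /kmin; elim/big_ind: _ => [|_ _ [i <-] [j <-]|i _]; first by exists ord0.
- by case: leP => _; [exists i|exists j].
- by exists i.
Qed.

Lemma kmax_eq (k : ivec) M i : k i = M -> (forall j, k j <= M) -> kmax k = M.
Proof.
move=> e h; have [j ej] := kmax_attained k.
by apply/eqP; rewrite eq_le -{1}ej h -e kmax_ge.
Qed.

Lemma kmin_eq (k : ivec) M i : k i = M -> (forall j, M <= k j) -> kmin k = M.
Proof.
move=> e h; have [j ej] := kmin_attained k.
by apply/eqP; rewrite eq_le -{2}ej h -e kmin_le.
Qed.

(** A second point of the class in the closed window would force, by [closed_window_extremes], a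
    difference of exactly 4n between two coordinates of [i]. So only [i] contributes, with weight
    1. *)
Lemma sum_cweight_interior (R : realType) (n : nat) (i : ivec) : (0 < n)%N -> inHn n i ->
  kmax i - kmin i < (4 * n)%:Z ->
  \sum_(j <- Hn_star_seq n | cong n j i) cweight R n j = 1.
Proof.
move=> n0 /inHnP[iH wi] ri.
have [si _] := inHP _ iH; have N0 : 0 < (4 * n)%:Z by lia.
have ci := window_closed _ _ (ltW N0) wi.
rewrite (sum_unique _ _ _ _ _ i) ?uniq_Hn_star //.
- by rewrite /cweight ri.
- by rewrite mem_Hn_star; apply/inHn_starP.
- by apply/forallP => x; rewrite subrr.
move=> j; rewrite mem_Hn_star => /inHn_starP[/inHP[sj _] cj].
rewrite cong_sym => /congP[] // m [sm ej].
have z x : m x = 0.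
  apply/eqP/negPn/negP => /(sum0_signs _ _ sm)[a [b [ma mb]]].
  have cim : closed_window (4 * n)%:Z (fun x => i x - (4 * n)%:Z * (m x)%:~R).
    by move=> x' y'; rewrite !intz; have := cj x' y'; rewrite ej.
  have [] := closed_window_extremes _ _ m N0 ci cim a b ma mb.
  by have := kmax_ge i a; have := kmin_le i b; lia.
by rewrite ej; apply: funext => x; rewrite z mulr0 subr0.
Qed.

(** * Classes that meet the boundary of H_n^* *)

Section BoundaryFiber.
Variables (n : nat) (i : ivec).
Hypotheses (n_gt0 : (0 < n)%N) (iH : inH i) (ri : kmax i - kmin i = (4 * n)%:Z).

Local Notation M := (kmax i).
Local Notation mn := (kmin i).
Local Notation B := [set x : 'I_4 | (i x == M) || (i x == mn)].
Local Notation Amax := [set x : 'I_4 | i x == M].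
Local Notation Amin := [set x : 'I_4 | i x == mn].

(** Candidates for the members of the class of [i]: among the extremal coordinates [B], those in [A]
    carry the maximum and the others the minimum. The admissible [A] are the subsets of [B] of the
    size of [Amax]. *)
Definition swap_to (A : {set 'I_4}) : ivec :=
  fun x => if x \in B then (if x \in A then M else mn) else i x.

Let M_neq : M != mn.
Proof. by apply/eqP; lia. Qed.

Lemma swap_to_Amax : swap_to Amax = i.
Proof.
apply: funext => x; rewrite /swap_to !inE.
by case: (eqVneq (i x) M) => [->|_] //=; case: eqVneq => [->|].
Qed.

Lemma sum_swap_to (A : {set 'I_4}) : A \subset B ->
  \sum_x swap_to A x = (4 * n)%:Z * #|A|%:Z + \sum_x (if x \in B then mn else i x).
Proof.
move=> /fintype.subsetP AB.
have -> : (4 * n)%:Z * #|A|%:Z = \sum_x (if x \in A then (4 * n)%:Z else 0).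
  by rewrite -big_mkcond /= sumr_const -mulr_natr natz.
rewrite -big_split; apply: eq_bigr => x _ /=; rewrite /swap_to.
by case: ifP => [_|/negP xB]; case: ifP => xA; rewrite ?add0r // -?ri ?subrK //; case: xB; exact: AB.
Qed.

(** The sum is affine in the size of [A] with slope 4n > 0, and it vanishes at [A = Amax], where
    [swap_to A] is [i]. *)
Lemma sum_swap_to_eq0 (A : {set 'I_4}) : A \subset B ->
  (\sum_x swap_to A x == 0) = (#|A| == #|Amax|).
Proof.
move=> AB; have [si _] := inHP _ iH.
have AmB : Amax \subset B by apply/fintype.subsetP => x; rewrite !inE => ->.
have e := sum_swap_to _ AmB; rewrite swap_to_Amax si in e.
rewrite sum_swap_to //.
have -> : \sum_x (if x \in B then mn else i x) = - ((4 * n)%:Z * #|Amax|%:Z).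
  by apply/eqP; rewrite -addr_eq0 addrC -e.
rewrite subr_eq0 (inj_eq (mulfI _)) ?eqz_nat //; lia.
Qed.

Lemma swap_to_bounds (A : {set 'I_4}) x : mn <= swap_to A x <= M.
Proof.
have := kmax_ge i x; have := kmin_le i x; rewrite /swap_to.
by case: ifP => _; [case: ifP => _|]; lia.
Qed.

Lemma swap_to_Hn_star (A : {set 'I_4}) : A \subset B -> #|A| = #|Amax| ->
  inHn_star n (swap_to A) /\ cong n (swap_to A) i.
Proof.
move=> AB cA.
have sA : \sum_x swap_to A x = 0 by apply/eqP; rewrite sum_swap_to_eq0 // cA.
have c : cong n (swap_to A) i.
  apply/forallP => x; rewrite /swap_to !inE.
  case: (eqVneq (i x) M) => [->|_] /=; last case: (eqVneq (i x) mn) => [->|_] /=.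
  - by case: ifP; rewrite ?subrr // -rpredN opprB ri dvdzz.
  - by case: ifP; rewrite ?subrr // ri dvdzz.
  - by rewrite subrr.
split=> //; apply/inHn_starP; split; first by apply: (inH_cong n i); rewrite 1?cong_sym.
by move=> x y; have := swap_to_bounds A x; have := swap_to_bounds A y; lia.
Qed.

Lemma Hn_star_cong_swap_to (j : ivec) : closed_window (4 * n)%:Z i ->
  inHn_star n j -> cong n j i ->
  exists A : {set 'I_4}, [/\ A \subset B, #|A| = #|Amax| & j = swap_to A].
Proof.
move=> ci /inHn_starP[/inHP[sj _] cj]; have [si _] := inHP _ iH.
rewrite cong_sym => /congP[] // m [sm ej].
have N0 : 0 < (4 * n)%:Z by lia.
have cim : closed_window (4 * n)%:Z (fun x => i x - (4 * n)%:Z * (m x)%:~R).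
  by move=> x y; rewrite !intz; have := cj x y; rewrite ej.
(* The difference [i a - i b] equals 4n, the whole range of [i], so the two coordinates are the
   maximum and the minimum. *)
have ext a b (ma : 0 < m a) (mb : m b < 0) :
    [/\ i a = M, i b = mn, m a = 1 & m b = -1].
  have [e -> ->] := closed_window_extremes _ _ m N0 ci cim a b ma mb.
  have := kmax_ge i a; have := kmin_le i a; have := kmax_ge i b; have := kmin_le i b.
  by split=> //; lia.
(* A nonzero [m x] has a partner of opposite sign because [m] sums to 0; [ext] then shows that a
   coordinate is either kept or switched between the two extremes. *)
have dich x : [\/ j x = i x, i x = M /\ j x = mn | i x = mn /\ j x = M].
  have jx : j x = i x - (4 * n)%:Z * m x by rewrite ej.
  case: (eqVneq (m x) 0) => [mx|mx]; first by constructor 1; rewrite jx mx; ring.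
  have [a [b [ma mb]]] := sum0_signs _ _ sm mx.
  case: (ltgtP (m x) 0) mx => // mx _.
  - by have [_ ix _ m1] := ext _ _ ma mx; constructor 3; rewrite jx m1 ix; split=> //; lia.
  - by have [ix _ m1 _] := ext _ _ mx mb; constructor 2; rewrite jx m1 ix; split=> //; lia.
exists [set x | j x == M].
have AB : [set x | j x == M] \subset B.
  apply/fintype.subsetP => x; rewrite !inE => /eqP jM.
  by case: (dich x) => [<-|[-> _]|[-> _]]; rewrite ?jM ?eqxx ?orbT.
have jE : j = swap_to [set x | j x == M].
  apply: funext => x; rewrite /swap_to !inE.
  case: (dich x) => [->|[-> ->]|[-> ->]]; rewrite ?eqxx ?orbT ?(negPf M_neq) 1?eq_sym ?(negPf M_neq) //.
  by case: (eqVneq (i x) M) => [->|_] //=; case: eqVneq => [->|].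
split=> //; apply/eqP; rewrite -sum_swap_to_eq0 // -jE sj //.
Qed.

(** The maximum and minimum of [swap_to A] are still those of [i], attained exactly on [A] and on
    [B :\: A], whose sizes are those of [Amax] and [Amin]. The weight is therefore constant on the
    class. *)
Lemma cweight_swap_to (R : realType) (A : {set 'I_4}) : A \subset B -> #|A| = #|Amax| ->
  cweight R n (swap_to A) = ('C(#|B|, #|Amax|)%:R)^-1.
Proof.
move=> AB cA.
have cardB : #|B| = (#|Amax| + #|Amin|)%N.
  rewrite -cardsUI -[X in (X + _)%N]/(#|_|) (_ : Amax :&: Amin = finset.set0) ?cards0 ?addn0.
    by apply: eq_card => x; rewrite !inE.
  apply/setP => x; rewrite !inE; apply/negP => /andP[/eqP -> ]; exact/negP.
have xmax : [set x | swap_to A x == M] = A.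
  apply/setP => x; rewrite inE /swap_to; case: ifP => xB.
    by case: ifP => xA; rewrite ?eqxx // eq_sym (negPf M_neq).
  apply/idP/idP => [iM|/(fintype.subsetP AB)]; last by rewrite xB.
  by move: xB; rewrite inE iM.
have xmin : [set x | swap_to A x == mn] = B :\: A.
  apply/setP => x; rewrite finset.in_setD [LHS]inE /swap_to; case: ifP => xB.
    by case: ifP => xA; rewrite ?eqxx // (negPf M_neq).
  by rewrite andbF; apply/negP => im; move: xB; rewrite inE im orbT.
have cD : #|B :\: A| = #|Amin|.
  by rewrite cardsD (finset.setIidPr AB) cA cardB addKn.
(* The extreme values persist because neither [A] nor [B :\: A] is empty. *)
have [a Ma] : exists a, swap_to A a = M.
  have [x ix] := kmax_attained i.
  have : (0 < #|A|)%N by rewrite cA card_gt0; apply/finset.set0Pn; exists x; rewrite inE ix.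
  by rewrite card_gt0 => /finset.set0Pn[a]; rewrite -{1}xmax inE => /eqP; exists a.
have [b mb] : exists b, swap_to A b = mn.
  have [x ix] := kmin_attained i.
  have : (0 < #|B :\: A|)%N by rewrite cD card_gt0; apply/finset.set0Pn; exists x; rewrite inE ix.
  by rewrite card_gt0 => /finset.set0Pn[b]; rewrite -xmin inE => /eqP; exists b.
rewrite /cweight.
have -> : kmax (swap_to A) = M.
  by apply: (kmax_eq _ _ a) => // x; have /andP[] := swap_to_bounds A x.
have -> : kmin (swap_to A) = mn.
  by apply: (kmin_eq _ _ b) => // x; have /andP[] := swap_to_bounds A x.
by rewrite ri ltxx xmax xmin cD cA cardB.
Qed.

(** [swap_to] is a bijection from the subsets of [B] of size [#|Amax|] to the members of the class,
    and each of these has as weight the inverse of their number. *)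
Lemma sum_cweight_boundary (R : realType) : closed_window (4 * n)%:Z i ->
  \sum_(j <- Hn_star_seq n | cong n j i) cweight R n j = 1.
Proof.
move=> ci.
pose D := [set A : {set 'I_4} | A \subset B & #|A| == #|Amax|].
have inD A : A \in D -> A \subset B /\ #|A| = #|Amax| by rewrite inE => /andP[? /eqP].
have swap_inj : {in D &, injective swap_to}.
  have h (A A' : {set 'I_4}) : A \subset B -> swap_to A = swap_to A' -> A \subset A'.
    move=> /fintype.subsetP AB e; apply/fintype.subsetP => x xA.
    move: (congr1 (@^~ x) e); rewrite /swap_to (AB _ xA) xA.
    by case: ifP => // _ /eqP; rewrite (negPf M_neq).
  move=> A A' /inD[AB _] /inD[AB' _] e; apply/eqP.
  by rewrite finset.eqEsubset (h A A') // (h A' A).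
have perm : perm_eq [seq j <- Hn_star_seq n | cong n j i] [seq swap_to A | A <- enum D].
  apply: uniq_perm.
  - exact/filter_uniq/uniq_Hn_star.
  - rewrite map_inj_in_uniq ?enum_uniq // => A A'; rewrite !mem_enum; exact: swap_inj.
  move=> j; rewrite mem_filter mem_Hn_star; apply/andP/mapP => [[cj jn]|[A]].
    have [A [AB cA ->]] := Hn_star_cong_swap_to _ ci jn cj.
    by exists A => //; rewrite mem_enum inE AB cA eqxx.
  by rewrite mem_enum => /inD[AB cA] ->; have [] := swap_to_Hn_star _ AB cA.
rewrite -big_filter (perm_big _ perm) big_map big_enum /=.
rewrite (eq_bigr (fun=> ('C(#|B|, #|Amax|)%:R)^-1)) => [|A /inD[AB cA]]; last first.
  exact: cweight_swap_to.
rewrite sumr_const cards_draws -[_ *+ _]mulr_natl divff // pnatr_eq0 -lt0n bin_gt0.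
by apply: subset_leq_card; apply/fintype.subsetP => x; rewrite !inE => ->.
Qed.

End BoundaryFiber.

Lemma sum_cweight (R : realType) (n : nat) (i : ivec) : (0 < n)%N -> inHn n i ->
  \sum_(j <- Hn_star_seq n | cong n j i) cweight R n j = 1.
Proof.
move=> n0 hi; have /inHnP[iH wi] := hi.
have N0 : 0 < (4 * n)%:Z by lia.
have ci := window_closed _ _ (ltW N0) wi.
have [ri|ri] := ltP (kmax i - kmin i) (4 * n)%:Z; first exact: sum_cweight_interior.
apply: sum_cweight_boundary => //.
have [a ea] := kmax_attained i; have [b eb] := kmin_attained i.
by have := ci a b; lia.
Qed.

(** Transport along congruence, with weights [cweight] on H_n^* and 1 on H_n: each boundary point
    has one representative in H_n, and over each representative the weights sum to 1. *)
Lemma sum_Hn_star (R : realType) (n : nat) (F : ivec -> complex R) : (0 < n)%N ->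
  (forall j k, inH j -> inH k -> cong n j k -> F j = F k) ->
  \sum_(j <- Hn_star_seq n) cweight R n j * F j = \sum_(j <- Hn_seq n) F j.
Proof.
move=> n0 FF.
rewrite [RHS](eq_bigr (fun j => 1 * F j)) => [|j _]; last by rewrite mul1r.
apply: (transport_sum _ _ _ _ _ _ _ _ _ (cong n)).
- move=> j; rewrite mem_Hn_star => /inHn_starP[jH _].
  have [k kn ck] := cong_Hn_exists n _ n0 jH.
  rewrite (sum_unique _ _ _ _ _ k) ?uniq_Hn ?mem_Hn // => y; rewrite mem_Hn => yn cy.
  by apply: (cong_Hn_inj n) => //; apply: cong_trans ck; rewrite cong_sym.
- by move=> i; rewrite mem_Hn; apply: sum_cweight.
- by move=> j k; rewrite mem_Hn_star mem_Hn => /inHn_starP[jH _] /inHnP[kH _]; apply: FF.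
Qed.

(** * The characters phi_k *)

Definition expi {R : realType} (x : R) : complex R := Complex (cos x) (sin x).

Lemma expiD {R : realType} (x y : R) : expi (x + y) = expi x * expi y.
Proof. by rewrite /expi cosD sinD; congr Complex; rewrite /= addrC. Qed.

Lemma expi0 {R : realType} : expi (0 : R) = 1.
Proof. by rewrite /expi cos0 sin0. Qed.

Lemma conjc_expi {R : realType} (x : R) : conjc (expi x) = expi (- x).
Proof. by rewrite /expi cosN sinN. Qed.

Lemma expi_2pi_int {R : realType} (z : int) : expi (2 * pi * z%:~R : R) = 1.
Proof.
have e1 : expi (2 * pi : R) = 1.
  by rewrite /expi mulr_natl -[_ *+ 2]add0r cosD2pi sinD2pi cos0 sin0.
have e (n : nat) : expi (2 * pi * n%:R : R) = 1.
  elim: n => [|n IH]; first by rewrite mulr0 expi0.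
  by rewrite -[n.+1%:R]natr1 mulrDr mulr1 expiD IH e1 mulr1.
case: z => n; first exact: e.
rewrite NegzE rmorphN /= mulrN.
by have := expiD (2 * pi * n.+1%:R) (- (2 * pi * n.+1%:R) : R); rewrite subrr expi0 e mul1r.
Qed.

(** Reduce [x] to [y] in [0, 2 pi). If [y] is nonzero, [y / 2] lies in (0, pi), so [sin (y / 2) > 0]
    and the double angle formula gives [cos y < 1]. *)
Lemma expi_eq1 {R : realType} (x : R) : expi x = 1 -> exists z : int, x = 2 * pi * z%:~R.
Proof.
have p0 : 0 < 2 * pi :> R by rewrite mulr_gt0 ?pi_gt0.
move=> ex; exists (Num.floor (x / (2 * pi))); set z := Num.floor _.
pose y := x - 2 * pi * z%:~R.
have ey : expi y = 1 by rewrite /y -mulrN -rmorphN expiD ex expi_2pi_int mulr1.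
have y0 : 0 <= y.
  by rewrite subr_ge0 -ler_pdivlMl // mulrC floor_le.
have y1 : y < 2 * pi.
  by rewrite ltrBlDl -[X in _ + X]mulr1 -mulrDr -ltr_pdivrMl // mulrC -intrD1 floorD1_gt.
have [y00|y00] := eqVneq y 0; first by apply/eqP; rewrite -subr_eq0 -/y y00.
have s0 : 0 < sin (y / 2).
  have : 0 < y by rewrite lt_neqAle eq_sym y00.
  by move=> yp; apply: sin_gt0_pi; lra.
have : cos y = 1 by case: ey.
have -> : y = (y / 2) *+ 2 by rewrite -mulr_natr divfK.
rewrite cos_mulr2n => cy; have := cos2Dsin2 (y / 2).
have : 0 < sin (y / 2) ^+ 2 by rewrite exprn_gt0.
by move: cy; rewrite mulr2n; lra.
Qed.

Lemma phiE {R : realType} (k : ivec) (t : pt4 R) : phi k t = expi (pi / 2 * idot k t).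
Proof. by []. Qed.

Lemma phi_mul_conjc {R : realType} (k l : ivec) (t : pt4 R) :
  phi k t * conjc (phi l t) = phi (fun i => k i - l i) t.
Proof.
rewrite !phiE conjc_expi -expiD -mulrN -mulrDr -sumrN -big_split /=.
by do 2 congr (_ _); apply: eq_bigr => i _; rewrite rmorphB /= mulrBl.
Qed.

Lemma phiD {R : realType} (k : ivec) (s t : pt4 R) :
  phi k (fun i => s i + t i) = phi k s * phi k t.
Proof.
rewrite !phiE -expiD -mulrDr -big_split /=.
by do 2 congr (_ _); apply: eq_bigr => i _; rewrite mulrDr.
Qed.

Lemma phi_int {R : realType} (k : ivec) (m : 'I_4 -> int) :
  inH k -> \sum_i m i = 0 -> phi k (fun i => (m i)%:~R : R) = 1.
Proof.
move=> /inHP[_ dk] sm.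
rewrite phiE /idot; under eq_bigr do rewrite -rmorphM /=.
rewrite -rmorph_sum /=.
have /dvdzP[z ->] : (4 %| \sum_i k i * m i)%Z.
  (* As [m] sums to 0, a constant may be subtracted from [k]; the differences are multiples of 4,
     which turns the phase pi/2 into a multiple of 2 pi. *)
  have -> : \sum_i k i * m i = \sum_i (k i - k ord0) * m i.
    transitivity (\sum_i k i * m i - k ord0 * \sum_i m i); first by rewrite sm mulr0 subr0.
    by rewrite mulr_sumr -sumrB; apply: eq_bigr => i _; rewrite mulrBl.
  by apply: rpred_sum => i _; rewrite dvdz_mulr.
rewrite -[RHS](expi_2pi_int z); by congr expi; rewrite rmorphM /=; field.
Qed.

Lemma phi_periodic {R : realType} (k : ivec) (t : pt4 R) (m : 'I_4 -> int) :
  inH k -> \sum_i m i = 0 -> phi k (fun i => t i + (m i)%:~R) = phi k t.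
Proof. by move=> hk sm; rewrite phiD phi_int // mulr1. Qed.

Lemma phi_scale_cong {R : realType} (n : nat) (k j j' : ivec) : (0 < n)%N ->
  inH k -> inH j -> inH j' -> cong n j j' ->
  phi k (scale_pt R n j) = phi k (scale_pt R n j').
Proof.
move=> n0 hk /inHP[sj _] /inHP[sj' _]; rewrite cong_sym => /congP[] // m [sm ->].
rewrite -[RHS](phi_periodic _ _ (fun i => - m i)) ?sumrN ?sm ?oppr0 //.
congr phi; apply: funext => i; rewrite /scale_pt rmorphB !rmorphM !rmorphN /=.
by rewrite -!pmulrn; field; rewrite pnatr_eq0; lia.
Qed.

(** * Orthogonality on H_n *)

Lemma inHB (k l : ivec) : inH k -> inH l -> inH (fun i => k i - l i).
Proof.
move=> /inHP[sk dk] /inHP[sl dl]; apply/inHP; split=> [|a b].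
  by rewrite sumrB sk sl subrr.
have -> : k a - l a - (k b - l b) = (k a - k b) - (l a - l b) by ring.
exact: (rpredB (dk _ _) (dl _ _)).
Qed.

Lemma scale_ptD {R : realType} (n : nat) (j h : ivec) :
  scale_pt R n (fun i => j i + h i) = (fun i => scale_pt R n j i + scale_pt R n h i).
Proof. by apply: funext => i; rewrite /scale_pt rmorphD mulrDl. Qed.

Lemma sum_phi_eq0 {R : realType} (n : nat) (k : ivec) a : (0 < n)%N -> inH k ->
  ~~ ((4 * n)%:Z %| k a)%Z -> \sum_(j <- Hn_seq n) phi k (scale_pt R n j) = 0.
Proof.
move=> n0 kH ka; have [sk _] := inHP _ kH.
(* This is (1,1,1,1) - 4 e_a, an element of H with k.h = -4 k_a. Hence phi_k(h/4n) = exp(-2 pi i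
   k_a/(4n)), which is 1 only if 4n divides k_a. *)
pose h : ivec := fun i => 1 - 4 * (i == a)%:Z.
have sa : \sum_i (i == a)%:Z = 1 :> int.
  by rewrite (bigD1 a) //= eqxx big1 ?addr0 // => i /negPf ->.
have hH : inH h.
  apply/inHP; split=> [|i j]; last by rewrite /h; lia.
  by rewrite sumrB -mulr_sumr sa sumr_const card_ord.
have e := sum_Hn_shift _ n h (fun j => phi k (scale_pt R n j)) n0 hH
  (fun j j' => phi_scale_cong n k j j' n0 kH).
have ph : phi k (scale_pt R n h) != 1.
  have n0R : n%:R != 0 :> R by rewrite pnatr_eq0; lia.
  have dh : idot k (scale_pt R n h) = - (k a)%:~R / n%:R.
    rewrite /idot /scale_pt; under eq_bigr do rewrite mulrA -rmorphM /=.
    rewrite -mulr_suml -rmorph_sum /=.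
    have -> : \sum_i k i * h i = - 4 * k a.
      rewrite /h; under eq_bigr do rewrite mulrBr mulr1.
      rewrite sumrB sk sub0r (bigD1 a) //= eqxx big1 ?addr0; first by rewrite /=; lia.
      by move=> i /negPf ->; rewrite !mulr0.
    by rewrite rmorphM /= natrM; field.
  apply: contra ka; rewrite phiE dh => /eqP /expi_eq1[z ez].
  have p0 : pi != 0 :> R by rewrite gt_eqF ?pi_gt0.
  have : (k a)%:~R = ((4 * n)%:Z * - z)%:~R :> R.
    apply: (mulfI p0); rewrite rmorphM rmorphN /= -pmulrn natrM.
    have -> : pi * (k a)%:~R = - (pi / 2 * (- (k a)%:~R / n%:R)) * (2 * n%:R) :> R by field.
    by rewrite ez; ring.
  by move/intr_inj ->; rewrite dvdz_mulr.
(* Shift invariance says that the sum equals itself times a factor different from 1. *)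
move: e; under eq_bigr do rewrite scale_ptD phiD.
rewrite -mulr_suml => /eqP; rewrite -[X in _ == X]mulr1 -subr_eq0 -mulrBr mulf_eq0.
by rewrite subr_eq0 (negPf ph) orbF => /eqP.
Qed.

Lemma sum_phi_Hn {R : realType} (n : nat) (k l : ivec) : (0 < n)%N ->
  inHn n k -> inHn n l ->
  \sum_(j <- Hn_seq n) phi (fun i => k i - l i) (scale_pt R n j) =
  if k == l then (4 * n ^ 3)%:R else 0.
Proof.
move=> n0 kn ln; have /inHnP[kH _] := kn; have /inHnP[lH _] := ln.
case: eqVneq => [<-|kl].
  rewrite -size_Hn // -sum1_size natr_sum; apply: eq_bigr => j _.
  by rewrite phiE /idot big1 ?mulr0 ?expi0 // => i _; rewrite subrr mul0r.
have : ~~ cong n k l by apply: contra kl => ckl; apply/eqP/(cong_Hn_inj n).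
rewrite negb_forall => /existsP[a ha].
exact: (sum_phi_eq0 n _ a n0 (inHB _ _ kH lH)).
Qed.

(** * Translation invariance of the Lebesgue measure on R^3 *)

(** The section at [x] of the preimage of [A] is the [f2]-preimage of the section of [A] at [f1 x].
    Invariance of [m2] removes [f2], and a change of variables under [m1] removes [f1]. *)
Lemma product_measure_preserving (d1 d2 : measure_display) (T1 : measurableType d1)
    (T2 : measurableType d2) (R : realType) (m1 : {measure set T1 -> \bar R})
    (m2 : {sigma_finite_measure set T2 -> \bar R}) (f1 : T1 -> T1) (f2 : T2 -> T2) :
  measurable_fun [set: T1] f1 ->
  (forall B, measurable B -> m1 (f1 @^-1` B)%classic = m1 B) ->
  (forall C, measurable C -> m2 (f2 @^-1` C)%classic = m2 C) ->
  forall A, measurable A ->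
    (m1 \x m2)%E ((fun x : T1 * T2 => (f1 x.1, f2 x.2)) @^-1` A)%classic = (m1 \x m2)%E A.
Proof.
move=> mf1 h1 h2 A mA; rewrite /product_measure1.
have mh : measurable_fun [set: T1] (m2 \o xsection A) by apply: measurable_fun_xsection.
transitivity (\int[m1]_x ((m2 \o xsection A) \o f1) x)%E.
  apply: eq_integral => x _ /=; rewrite -(h2 _ (measurable_xsection (f1 x) mA)).
  by congr (m2 _); apply/seteqP; split=> y; rewrite /xsection /= !inE.
rewrite -[in LHS](preimage_setT f1) -ge0_integral_pushforward //.
apply: eq_measure_integral => B mB _; exact: h1.
Qed.

Section LebesgueShift.
Variable R : realType.
Local Notation mR := (measurableTypeR R).
Local Notation T := (mR * mR * mR)%type.
Local Notation mu := (@lebesgue_measure R).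

Lemma measurable_shift (v : R) : measurable_fun [set: mR] (fun x : mR => (x + v : mR)).
Proof. exact: measurable_funD. Qed.

(** By uniqueness of Lebesgue measure it suffices that the pushforward agree with it on the
    intervals ]a, b]. *)
Lemma lebesgue_measure_shift (v : R) (A : set mR) : measurable A ->
  mu ((fun x : mR => (x + v : mR)) @^-1` A)%classic = mu A.
Proof.
move=> mA; rewrite -[LHS]/(pushforward mu (fun x : mR => (x + v : mR)) A).
apply/esym/lebesgue_measure_unique => //= [|_ _ [[a b] _ <-]].
  exact: measurable_shift.
have -> : pushforward mu (fun x : mR => (x + v : mR)) `]a, b]%classic = mu `]a - v, b - v]%classic.
  rewrite /pushforward; congr (mu _); apply/seteqP; split=> x /=;
    by rewrite !in_itv /= ltrBlDr lerBrDr.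
by rewrite !lebesgue_measure_itv /= !lte_fin ltrBlDr subrK -!EFinB opprB addrA subrK.
Qed.

Definition shift3 (v x : T) : T := (x.1.1 + v.1.1, x.1.2 + v.1.2, x.2 + v.2).

Lemma measurable_coord1 : measurable_fun [set: T] (fun x : T => x.1.1).
Proof. by apply: (measurableT_comp measurable_fst); exact: measurable_fst. Qed.

Lemma measurable_coord2 : measurable_fun [set: T] (fun x : T => x.1.2).
Proof. by apply: (measurableT_comp measurable_snd); exact: measurable_fst. Qed.

Lemma measurable_coord3 : measurable_fun [set: T] (fun x : T => x.2).
Proof. exact: measurable_snd. Qed.

Lemma measurable_shift3 (v : T) : measurable_fun [set: T] (shift3 v).
Proof.
apply: measurable_fun_pair; last by apply: measurable_funD => //; exact: measurable_coord3.
apply: measurable_fun_pair; apply: measurable_funD => //.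
- exact: measurable_coord1.
- exact: measurable_coord2.
Qed.

Lemma leb3_shift (v : T) (A : set T) : measurable A -> leb3 (shift3 v @^-1` A)%classic = leb3 A.
Proof.
move=> mA.
apply: (product_measure_preserving _ _ _ _ _ _ _
  (fun p : mR * mR => (p.1 + v.1.1 : mR, p.2 + v.1.2 : mR)) (fun z : mR => (z + v.2 : mR))) => //.
- by apply: measurable_fun_pair; apply: measurable_funD.
- move=> B mB.
  apply: (product_measure_preserving _ _ _ _ _ _ _ (fun z : mR => (z + v.1.1 : mR))
    (fun z : mR => (z + v.1.2 : mR))) => //; first exact: measurable_shift.
  + exact: lebesgue_measure_shift.
  + exact: lebesgue_measure_shift.
- exact: lebesgue_measure_shift.
Qed.
End LebesgueShift.

(** * Fundamental domains of Z^3 *)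

(** For nonnegative functions this is integration against the pushforward, which equals [mu]; the
    general case takes positive and negative parts. *)
Lemma integral_preserving (d : measure_display) (X : measurableType d) (R : realType)
    (mu : {measure set X -> \bar R}) (h : X -> X) :
  measurable_fun [set: X] h ->
  (forall B, measurable B -> mu (h @^-1` B)%classic = mu B) ->
  forall (A : set X) (f : X -> \bar R), measurable A -> measurable_fun [set: X] f ->
  (\int[mu]_(x in A) f x = \int[mu]_(x in h @^-1` A) f (h x))%E.
Proof.
move=> mh hmu A f mA mf.
have ge0 g : measurable_fun [set: X] g -> (forall x, 0 <= g x)%E ->
    (\int[mu]_(x in A) g x = \int[mu]_(x in h @^-1` A) g (h x))%E.
  move=> mg g0; rewrite -[RHS](ge0_integral_pushforward mh) //; last exact: measurable_funTS.
  by apply: eq_measure_integral => B mB _; rewrite -[LHS]hmu.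
rewrite integralE [RHS]integralE; congr (_ - _)%E.
- by rewrite ge0 //; [apply: eq_integral => x _; rewrite !funeposE|exact: measurable_funepos].
- by rewrite ge0 //; [apply: eq_integral => x _; rewrite !funenegE|exact: measurable_funeneg].
Qed.

Section FundamentalDomains.
Variable R : realType.
Local Notation mR := (measurableTypeR R).
Local Notation T := (mR * mR * mR)%type.
Local Notation mu := (@lebesgue_measure R).
Local Notation Z3 := (int * int * int)%type.

Definition intv (m : Z3) : T := (m.1.1%:~R, m.1.2%:~R, m.2%:~R).

Lemma measurable_shift3_preimage (v : T) (A : set T) :
  measurable A -> measurable (shift3 R v @^-1` A)%classic.
Proof. by move=> mA; rewrite -[X in measurable X]setTI; exact: measurable_shift3. Qed.

Lemma integral_shift3 (v : T) (A : set T) (f : T -> \bar R) :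
  measurable A -> measurable_fun [set: T] f ->
  (\int[@leb3 R]_(x in A) f x =
   \int[@leb3 R]_(x in shift3 R v @^-1` A) f (shift3 R v x))%E.
Proof.
move=> mA mf.
exact: (integral_preserving _ _ _ _ _ (measurable_shift3 R v) (leb3_shift R v) _ _ mA mf).
Qed.

Definition bounded3 (b : R) (x : T) := [&& `|x.1.1| <= b, `|x.1.2| <= b & `|x.2| <= b].

(** The bound 3/2 leaves room for [OmegaH], bounded by 1, to be translated by a vector bounded by
    1/2. Two such domains then differ only by integer vectors bounded by 3, so all decompositions
    are finite. *)
Definition fundamental (D : set T) : Prop :=
  [/\ measurable D, (forall x, D x -> bounded3 (3 / 2) x),
      (forall x, exists m, D (shift3 R (intv m) x)) &
      (forall x m, D x -> D (shift3 R (intv m) x) -> m = 0)].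

Lemma shift3_intvD (m m' : Z3) (x : T) :
  shift3 R (intv m) (shift3 R (intv m') x) = shift3 R (intv (m' + m)) x.
Proof. by rewrite /shift3 /intv /= !rmorphD /= !addrA. Qed.

Lemma fundamental_split (D D' : set T) (G : T -> R) (s : seq Z3) :
  fundamental D -> fundamental D' -> measurable_fun [set: T] G -> uniq s ->
  (forall m, bounded3 3 (intv m) -> m \in s) ->
  (\int[@leb3 R]_(x in D) (G x)%:E =
   \sum_(m <- s) \int[@leb3 R]_(x in D `&` shift3 R (intv m) @^-1` D') (G x)%:E)%E.
Proof.
move=> [mD bD _ _] [mD' bD' eD' uD'] mG us hs.
have mF m : measurable (D `&` shift3 R (intv m) @^-1` D')%classic.
  by apply: measurableI => //; exact: measurable_shift3_preimage.
rewrite -integral_bigsetU_EFin //.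
- congr integral; rewrite -bigcup_seq; apply/seteqP; split=> [x Dx|x [m _ []] //].
  have [m D'm] := eD' x; exists m => //=; apply: hs.
  move: (bD x Dx) (bD' _ D'm); rewrite /bounded3 /shift3 /intv /=.
  by rewrite !ler_norml => /and3P[? ? ?] /and3P[? ? ?]; apply/and3P; split; lra.
- apply/trivIsetP => m m' _ _ mm'; apply/seteqP; split=> // x [[_ h] [_ h']].
  have e : shift3 R (intv m') x = shift3 R (intv (m' - m)) (shift3 R (intv m) x).
    by rewrite shift3_intvD addrC subrK.
  have /eqP : m' - m = 0 by apply: (uD' (shift3 R (intv m) x)); rewrite -?e.
  by rewrite subr_eq0 eq_sym (negPf mm').
- by apply: measurable_funTS; exact/measurable_EFinP.
Qed.

(** Cut [D] along the translates of [D'] and [D'] along those of [D]. The piece of [D] for [m] is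
    carried by the translation by [m] onto the piece of [D'] for [-m], hence the negated list, and
    [G] is unchanged. *)
Lemma fundamental_integral (D D' : set T) (G : T -> R) :
  fundamental D -> fundamental D' -> measurable_fun [set: T] G ->
  (forall m x, G (shift3 R (intv m) x) = G x) ->
  (\int[@leb3 R]_(x in D) (G x)%:E = \int[@leb3 R]_(x in D') (G x)%:E)%E.
Proof.
move=> fD fD' mG pG.
have [r [ur rP]] : exists r : seq int, uniq r /\ forall z : int, `|z%:~R : R| <= 3 -> z \in r.
  exists [:: -3; -2; -1; 0; 1; 2; 3]; split=> // z.
  by rewrite -intr_norm [X in _ <= X]pmulrn ler_int !inE; lia.
pose s := [seq (p, c) | p <- [seq (a, b) | a <- r, b <- r], c <- r] : seq Z3.
have us : uniq s by apply: allpairs_uniq => [||[? ?] [? ?]]; first apply: allpairs_uniq => // -[? ?] [? ?].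
have us' : uniq [seq - m | m <- s] by rewrite map_inj_uniq //; exact: oppr_inj.
have hs m : bounded3 3 (intv m) -> m \in s.
  case: m => [[a b] c] /and3P[/rP ha /rP hb /rP hc].
  by apply: allpairs_f hc; apply: allpairs_f.
have hs' m : bounded3 3 (intv m) -> m \in [seq - m | m <- s].
  move=> bm; rewrite -[m]opprK map_f // hs //.
  by move: bm; rewrite /bounded3 /intv /= !rmorphN /= !normrN.
have [mD _ _ _] := fD; have [mD' _ _ _] := fD'.
rewrite (fundamental_split D D' G s) // (fundamental_split D' D G [seq - m | m <- s]) // big_map.
apply: eq_bigr => m _.
rewrite [RHS](integral_shift3 (intv m)); [|apply: measurableI => //|exact/measurable_EFinP].
  under [RHS]eq_integral do rewrite pG.
  congr integral; apply/seteqP.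
  have e x : shift3 R (intv (- m)) (shift3 R (intv m) x) = x.
    by rewrite shift3_intvD subrr /shift3 /= !addr0; case: x => [[? ?] ?].
  split=> x; rewrite /preimage /setI /mkset e; case; by split.
exact: measurable_shift3_preimage.
Qed.

(** The preimage of [D] under the shift by [v] is again fundamental. Shifting and then returning to
    [D] by periodicity shows that the integral is its own opposite; integrability makes it finite,
    hence 0. *)
Lemma integral_antiperiodic (D : set T) (G : T -> R) (v : T) :
  fundamental D -> bounded3 (1 / 2) v -> (forall x, D x -> bounded3 1 x) ->
  measurable_fun [set: T] G ->
  (forall m x, G (shift3 R (intv m) x) = G x) ->
  (forall x, G (shift3 R v x) = - G x) ->
  (@leb3 R).-integrable D (EFin \o G) ->
  Rintegral (@leb3 R) D G = 0.
Proof.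
move=> fD bv bD mG pG aG iG.
have [mD _ eD uD] := fD.
have sC w w' x : shift3 R w (shift3 R w' x) = shift3 R w' (shift3 R w x).
  by rewrite /shift3 /=; congr (_, _, _); ring.
have fS : fundamental (shift3 R v @^-1` D)%classic.
  split=> [|x /bD|x|x m].
  - exact: measurable_shift3_preimage.
  - move: bv; rewrite /bounded3 /shift3 /= !ler_norml.
    by move=> /and3P[? ? ?] /and3P[? ? ?]; apply/and3P; split; lra.
  - by have [m Dm] := eD (shift3 R v x); exists m; rewrite /preimage /mkset sC.
  - rewrite /preimage /mkset sC; exact: uD.
have e : (\int[@leb3 R]_(x in D) (G x)%:E = (-1)%:E * \int[@leb3 R]_(x in D) (G x)%:E)%E.
  rewrite -integralZl // [LHS](integral_shift3 v) //; last exact/measurable_EFinP.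
  under [LHS]eq_integral do rewrite aG.
  rewrite -(fundamental_integral D _ (fun x => - G x) fD fS); last 2 first.
  - exact: measurable_funN.
  - by move=> m x; rewrite pG.
  by apply: eq_integral => x _; rewrite /= -EFinM mulN1r.
have fin : (\int[@leb3 R]_(x in D) (G x)%:E)%E \is a fin_num by exact: integrable_fin_num.
by move: e; rewrite /Rintegral -(fineK fin) -EFinM => -[e]; move: e; rewrite fineK //; lra.
Qed.

Lemma leb3_cube_fundamental :
  fundamental (`[0, 1[ `*` `[0, 1[ `*` `[0, 1[)%classic /\
  leb3 (`[0, 1[ `*` `[0, 1[ `*` `[0, 1[ : set T)%classic = 1%E.
Proof.
have m1 : measurable (`[0, 1[%classic : set mR) by exact: measurable_itv.
have m3 : measurable (`[0, 1[ `*` `[0, 1[ `*` `[0, 1[ : set T)%classic.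
  by apply: measurableX => //; exact: measurableX.
have fl (z : R) : exists k : int, 0 <= z + k%:~R < 1.
  exists (- Num.floor z); rewrite rmorphN /= subr_ge0 floor_le /=.
  by have := floorD1_gt z; rewrite intrD1; lra.
have un (z : R) (k : int) : 0 <= z < 1 -> 0 <= z + k%:~R < 1 -> k = 0.
  move=> h h'; have : -1 < (k%:~R : R) < 1 by lra.
  by rewrite -[1]/(1%:~R) -rmorphN !ltr_int; lia.
split; last first.
  pose I01 : set mR := `[0, 1[%classic.
  have mI : mu I01 = 1%E by rewrite lebesgue_measure_itv /= lte_fin ltr01 oppr0 adde0.
  transitivity (mu I01 * mu I01 * mu I01)%E; last by rewrite mI !mule1.
  rewrite /leb3 product_measure1E //; last exact: measurableX.
  by rewrite /= product_measure1E.
split=> // [[[x y] z] /=|[[x y] z]|[[x y] z] [[a b] c]].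
- rewrite !in_itv /= => -[[? ?] ?]; rewrite /bounded3 /= !ler_norml.
  by apply/and3P; split; lra.
- have [a ha] := fl x; have [b hb] := fl y; have [c hc] := fl z.
  by exists (a, b, c); rewrite /shift3 /intv /=; do 2 split=> //=; rewrite in_itv.
- rewrite /shift3 /intv /= !in_itv /= => -[[hx hy] hz] [[hx' hy'] hz'].
  by rewrite (un _ _ hx hx') (un _ _ hy hy') (un _ _ hz hz').
Qed.

(** Compare with the unit cube, integrating the constant 1. *)
Lemma leb3_fundamental (D : set T) : fundamental D -> leb3 D = 1%E.
Proof.
move=> fD; have [fC <-] := leb3_cube_fundamental.
have [mD _ _ _] := fD; have [mC _ _ _] := fC.
have := fundamental_integral D _ (fun=> 1) fD fC (measurable_cst _) (fun _ _ => erefl).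
by rewrite !integral_cst // !mul1e.
Qed.
End FundamentalDomains.

(** * OmegaH as a fundamental domain *)

Section Omega.
Variable R : realType.
Local Notation mR := (measurableTypeR R).
Local Notation T := (mR * mR * mR)%type.

Lemma mk4RE (a b c d : R) : (mk4R a b c d (inord 0) = a) * (mk4R a b c d (inord 1) = b) *
  (mk4R a b c d (inord 2) = c) * (mk4R a b c d (inord 3) = d).
Proof. by rewrite /mk4R !inordK. Qed.

Lemma sum_embedH (x : T) : \sum_i embedH x i = 0.
Proof. by rewrite sum4 /embedH !mk4RE; ring. Qed.

Lemma embedH_shift3 (v x : T) :
  embedH (shift3 R v x) = (fun i => embedH x i + embedH v i).
Proof.
apply: funext; apply: all4; rewrite /embedH !mk4RE //=.
by ring.
Qed.

(** The integral counterpart of [embedH]: integer translations of the three parameters are exactly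
    the translations by Z^4_H. *)
Definition ext3 (m : int * int * int) : ivec := mk4 m.1.1 m.1.2 m.2 (- m.1.1 - m.1.2 - m.2).

Lemma sum_ext3 m : \sum_i ext3 m i = 0.
Proof. by rewrite sum4 /ext3 !mk4E; ring. Qed.

Lemma embedH_intv m : embedH (intv R m) = (fun i => (ext3 m i)%:~R).
Proof.
by apply: funext; apply: all4; rewrite /embedH /ext3 !mk4RE !mk4E //= !rmorphB rmorphN.
Qed.

Lemma measurable_embedH i : measurable_fun [set: T] (fun x : T => (embedH x i : mR)).
Proof.
have m1 := measurable_coord1 R; have m2 := measurable_coord2 R; have m3 := measurable_coord3 R.
move: i; apply: all4; rewrite /embedH.
- by under eq_fun do rewrite mk4RE.
- by under eq_fun do rewrite mk4RE.
- by under eq_fun do rewrite mk4RE.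
- under eq_fun do rewrite mk4RE.
  by apply: measurable_funB => //; apply: measurable_funB => //; exact: measurable_funN.
Qed.

Lemma measurable_OmegaH : measurable (@OmegaH R : set T).
Proof.
pose F (p : 'I_4 * 'I_4) : set T := if (p.1 < p.2)%N then
  ((fun x : T => (embedH x p.1 - embedH x p.2 : mR)) @^-1` `]-1, 1])%classic else setT.
have -> : @OmegaH R = (\bigcap_(p in [set: 'I_4 * 'I_4]) F p)%classic.
  apply/seteqP; split=> [x h [i j] _|x h i j ij].
    by rewrite /F /=; case: ifP => // ij; rewrite /preimage /mkset in_itv /=; apply/andP/h.
  by have := h (i, j) I; rewrite /F /= ij /preimage /mkset in_itv /= => /andP.
apply: fin_bigcap_measurable => [|[i j] _]; first exact: finite_finset.
rewrite /F; case: ifP => // _; rewrite -[X in measurable X]setTI.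
by apply: measurable_funB => //; exact: measurable_embedH.
Qed.

Lemma OmegaH_bounded (x : T) : @OmegaH R x -> bounded3 R 1 x.
Proof.
move=> hx; have c : closed_window 1 (embedH x) by apply: window_closed.
have s := sum_embedH x; rewrite sum4 in s.
(* The coordinates sum to 0, so each is the mean of its differences with all four. *)
have c4 i : `|embedH x i| <= 1.
  have := c i (inord 0); have := c i (inord 1); have := c i (inord 2); have := c i (inord 3).
  have := c (inord 0) i; have := c (inord 1) i; have := c (inord 2) i; have := c (inord 3) i.
  by rewrite ler_norml; lra.
have := c4 (inord 0); have := c4 (inord 1); have := c4 (inord 2); rewrite /embedH !mk4RE.
by move=> ? ? ?; apply/and3P.
Qed.

Lemma OmegaH_fundamental : fundamental R (@OmegaH R).
Proof.
split.
- exact: measurable_OmegaH.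
- move=> x /OmegaH_bounded /and3P[? ? ?]; apply/and3P; split; lra.
- move=> x.
  have [|m [sm wm]] := window_exists 1 (embedH x) (fun i => Num.floor (embedH x i))
    ltr01 (sum_embedH x).
    move=> i; rewrite mul1r subr_ge0 floor_le /=.
    by have := floorD1_gt (embedH x i); rewrite intrD1; lra.
  (* The signs change because [window_exists] subtracts [m] whereas [shift3] adds. *)
  pose m3 := (- m (inord 0), - m (inord 1), - m (inord 2)).
  have em : ext3 m3 = (fun i => - m i).
    apply: funext; apply: all4; rewrite /ext3 !mk4E //=.
    by move: sm; rewrite sum4; lia.
  exists m3; rewrite -[@OmegaH R _]/(window 1 (embedH (shift3 R (intv R m3) x))).
  rewrite embedH_shift3 embedH_intv em => i j /wm.
  by rewrite !mul1r !rmorphN.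
- move=> x m w w'; have z : forall i, - ext3 m i = 0.
    apply: (window_unique 1 (embedH x)) => //.
      by rewrite sumrN sum_ext3 oppr0.
    move=> i j ij; have := w' i j ij; rewrite embedH_shift3 embedH_intv.
    by rewrite !mul1r !rmorphN !opprK.
  case: m w' z => [[a b] c] _ z; have := z (inord 0); have := z (inord 1); have := z (inord 2).
  rewrite /ext3 !mk4E /= => /eqP + /eqP + /eqP.
  by rewrite !oppr_eq0 => /eqP -> /eqP -> /eqP ->.
Qed.

Lemma measurable_idot (k : ivec) : measurable_fun [set: T] (fun x : T => (idot k (embedH x) : mR)).
Proof.
have mk i : measurable_fun [set: T] (fun x : T => ((k i)%:~R * embedH x i : mR)).
  by apply: measurable_funM => //; exact: measurable_embedH.
under eq_fun do rewrite /idot sum4.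
by repeat (exact: mk || apply: measurable_funD).
Qed.

Lemma measurable_Re_phi (k : ivec) :
  measurable_fun [set: T] (fun x : T => complex.Re (phi k (embedH x)) : mR).
Proof.
apply: (measurableT_comp (f := (cos : mR -> mR))).
  by apply: continuous_measurable_fun; exact: continuous_cos.
by apply: measurable_funM => //; exact: measurable_idot.
Qed.

Lemma measurable_Im_phi (k : ivec) :
  measurable_fun [set: T] (fun x : T => complex.Im (phi k (embedH x)) : mR).
Proof.
apply: (measurableT_comp (f := (sin : mR -> mR))).
  by apply: continuous_measurable_fun; exact: continuous_sin.
by apply: measurable_funM => //; exact: measurable_idot.
Qed.

Lemma integrable_OmegaH (G : T -> R) : measurable_fun [set: T] G ->
  (forall x, `|G x| <= 1) -> (@leb3 R).-integrable (@OmegaH R) (EFin \o G).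
Proof.
move=> mG G1; apply: measurable_bounded_integrable.
- exact: measurable_OmegaH.
- by rewrite -[X in (X < _)%E]/(leb3 (@OmegaH R)) (leb3_fundamental R _ OmegaH_fundamental) ltry.
- exact: measurable_funTS.
- exists 1; split=> // M M1 x _ /=; exact: le_trans (G1 x) (ltW M1).
Qed.

(** Since [k] is nonzero with sum 0, some k_a with a < 3 differs from k_3. Moving coordinate a by c
    = 2/(k_a - k_3) and the last one by -c gives k.v = 2, hence phase pi. The difference is a
    nonzero multiple of 4, so |c| <= 1/2. *)
Lemma phi_embedH_antiperiod (k : ivec) : inH k -> (exists i, k i != 0) ->
  exists2 v : T, bounded3 R (1 / 2) v & phi k (embedH v) = -1.
Proof.
move=> /inHP[sk dk] [i0 ki0].
have [a /andP[a3 ka]] : exists a : 'I_4, (a < 3)%N && (k a != k (inord 3)).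
  apply/existsP; apply: contraT; rewrite negb_exists => /forallP h.
  have e a : (a < 3)%N -> k (inord a) = k (inord 3).
    move=> a3; apply/eqP; have := h (inord a); rewrite inordK ?a3 ?negbK //.
    by rewrite (leq_trans a3).
  exfalso; move: ki0; apply/negP; rewrite negbK; move: i0; apply: all4;
    move: sk; rewrite sum4 !e //; lia.
pose d := k a - k (inord 3).
have d4 : (4 <= absz d)%N.
  have := dk a (inord 3); rewrite -/d; move: ka; rewrite -subr_eq0 -/d; lia.
have dR : d%:~R != 0 :> R by rewrite intr_eq0; lia.
pose c : R := 2 / d%:~R.
have c2 : `|c| <= 1 / 2.
  rewrite /c normrM normfV normr_nat ler_pdivrMr ?normr_gt0 //.
  have : 4%:~R <= `|d|%:~R :> R by rewrite ler_int; lia.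
  rewrite intr_norm; lra.
have expi_pi : expi pi = -1 :> complex R.
  by rewrite /expi cospi sinpi; apply/eqP; rewrite eq_complex /= oppr0 !eqxx.
have dot (v : T) : idot k (embedH v) = (k (inord 0) - k (inord 3))%:~R * v.1.1
    + (k (inord 1) - k (inord 3))%:~R * v.1.2 + (k (inord 2) - k (inord 3))%:~R * v.2.
  by rewrite /idot sum4 /embedH !mk4RE !rmorphB /=; ring.
exists (c * (a == inord 0)%:R, c * (a == inord 1)%:R, c * (a == inord 2)%:R).
  have cb (b : bool) : `|c * b%:R| <= 1 / 2 by case: b; rewrite ?mulr1 // mulr0 normr0; lra.
  by apply/and3P; split; exact: cb.
rewrite phiE -expi_pi; congr expi.
rewrite dot /=.
have -> : (k (inord 0) - k (inord 3))%:~R * (c * (a == inord 0)%:R) +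
  (k (inord 1) - k (inord 3))%:~R * (c * (a == inord 1)%:R) +
  (k (inord 2) - k (inord 3))%:~R * (c * (a == inord 2)%:R) = d%:~R * c.
  rewrite /d -(inord_val a); move: a3.
  have E i j : (i < 4)%N -> (j < 4)%N -> (inord i == inord j :> 'I_4) = (i == j).
    by move=> hi hj; rewrite -val_eqE /= !inordK.
  case: (nat_of_ord a) => [|[|[|m]]] // _; rewrite !E //=;
    by rewrite !(mulr0, mulr1, addr0, add0r).
by rewrite /c; field.
Qed.
End Omega.

(** * The inner products on calH_n *)

Lemma Rintegral_lincomb (d : measure_display) (X : measurableType d) (R : realType)
    (mu : {measure set X -> \bar R}) (D : set X) (a b c : X -> R) (r s : R) :
  measurable D -> mu.-integrable D (EFin \o a) -> mu.-integrable D (EFin \o b) ->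
  mu.-integrable D (EFin \o c) ->
  mu.-integrable D (EFin \o (fun x => r * a x + s * b x + c x)) /\
  Rintegral mu D (fun x => r * a x + s * b x + c x) =
  r * Rintegral mu D a + s * Rintegral mu D b + Rintegral mu D c.
Proof.
move=> mD ia ib ic.
have iZ (t : R) g : mu.-integrable D (EFin \o g) ->
    mu.-integrable D (EFin \o (fun x => t * g x)).
  by move=> ig; apply: eq_integrable (integrableZl mD t ig).
have iD g h : mu.-integrable D (EFin \o g) -> mu.-integrable D (EFin \o h) ->
    mu.-integrable D (EFin \o (fun x => g x + h x)).
  by move=> ig ih; apply: eq_integrable (integrableD mD ig ih).
have iab := iD _ _ (iZ r _ ia) (iZ s _ ib).
split; first exact: iD.
by rewrite !RintegralD // ?RintegralZl //; apply: iZ.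
Qed.

Section ComplexIntegral.
Variable R : realType.
Local Notation C := (complex R).

Definition integrableH (F : pt4 R -> C) : Prop :=
  (@leb3 R).-integrable (@OmegaH R) (EFin \o (fun x => complex.Re (F (embedH x)))) /\
  (@leb3 R).-integrable (@OmegaH R) (EFin \o (fun x => complex.Im (F (embedH x)))).

Lemma intH_axpy (c : C) (F G : pt4 R -> C) : integrableH F -> integrableH G ->
  integrableH (fun t => c * F t + G t) /\
  intH (@OmegaH R) (fun t => c * F t + G t) =
  c * intH (@OmegaH R) F + intH (@OmegaH R) G.
Proof.
move=> [rF iF] [rG iG]; case: c => a b.
have mD := measurable_OmegaH R.
have eR : (fun x => complex.Re (Complex a b * F (embedH x) + G (embedH x))) =
    (fun x => a * complex.Re (F (embedH x)) + (- b) * complex.Im (F (embedH x)) +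
      complex.Re (G (embedH x))).
  by apply: funext => x; case: (F _) => u v; case: (G _) => w z; rewrite /= mulNr.
have eI : (fun x => complex.Im (Complex a b * F (embedH x) + G (embedH x))) =
    (fun x => b * complex.Re (F (embedH x)) + a * complex.Im (F (embedH x)) +
      complex.Im (G (embedH x))).
  by apply: funext => x; case: (F _) => u v; case: (G _) => w z; rewrite /= [X in X + _]addrC.
have [i1 e1] := Rintegral_lincomb _ _ R _ _ _ _ _ a (- b) mD rF iF rG.
have [i2 e2] := Rintegral_lincomb _ _ R _ _ _ _ _ b a mD rF iF iG.
rewrite /integrableH /intH.
rewrite eR eI e1 e2; split; first by split.
rewrite mulrCA -mulrDr; congr (_ * _).
by apply/eqP; rewrite eq_complex; apply/andP; split; apply/eqP; rewrite /=; ring.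
Qed.

Lemma integrableH0 : integrableH (fun=> 0).
Proof. by split; apply: integrable_OmegaH => // x; rewrite normr0. Qed.

Lemma intH0 : intH (@OmegaH R) (fun=> 0) = 0 :> C.
Proof.
(* Writing 0 as -1 * 0 + 0, linearity gives an integral of the form -I + I. *)
have e := (intH_axpy (-1) _ _ integrableH0 integrableH0).2.
have -> : (fun=> 0) = (fun t : pt4 R => -1 * 0 + 0 : C) by apply: funext => t; rewrite mulr0 addr0.
by rewrite e mulN1r addNr.
Qed.

Lemma intH_sum (P : Type) (s : seq P) (c : P -> C) (F : P -> pt4 R -> C) :
  (forall p, integrableH (F p)) ->
  intH (@OmegaH R) (fun t => \sum_(p <- s) c p * F p t) =
  \sum_(p <- s) c p * intH (@OmegaH R) (F p).
Proof.
move=> iF.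
suff [] : integrableH (fun t => \sum_(p <- s) c p * F p t) /\
  intH (@OmegaH R) (fun t => \sum_(p <- s) c p * F p t) =
  \sum_(p <- s) c p * intH (@OmegaH R) (F p) by [].
elim: s => [|p s [iS IH]].
  rewrite big_nil (_ : (fun _ => _) = (fun=> 0)); first by split; [exact: integrableH0|exact: intH0].
  by apply: funext => t; rewrite big_nil.
have -> : (fun t => \sum_(q <- p :: s) c q * F q t) =
    (fun t => c p * F p t + \sum_(q <- s) c q * F q t).
  by apply: funext => t; rewrite big_cons.
by rewrite big_cons -IH; exact: intH_axpy.
Qed.

Lemma integrableH_phi (k : ivec) : integrableH (phi k).
Proof.
split; apply: integrable_OmegaH.
- exact: measurable_Re_phi.
- by move=> x; rewrite /= ler_norml cos_geN1 cos_le1.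
- exact: measurable_Im_phi.
- by move=> x; rewrite /= ler_norml sin_geN1 sin_le1.
Qed.

(** The factor -1 is real, so the real and imaginary parts are antiperiodic separately and each
    integral vanishes. *)
Lemma intH_phi_eq0 (k : ivec) : inH k -> (exists i, k i != 0) ->
  intH (@OmegaH R) (phi k) = 0 :> C.
Proof.
move=> kH k0; have [v bv pv] := phi_embedH_antiperiod R k kH k0.
have per m x : phi k (embedH (shift3 R (intv R m) x)) = phi k (embedH x).
  by rewrite embedH_shift3 embedH_intv; apply: phi_periodic => //; exact: sum_ext3.
have anti x : phi k (embedH (shift3 R v x)) = - phi k (embedH x).
  by rewrite embedH_shift3 phiD pv mulrN1.
have [iR iI] := integrableH_phi k.
rewrite /intH.
rewrite (integral_antiperiodic R _ _ v (OmegaH_fundamental R) bv (@OmegaH_bounded R)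
  (measurable_Re_phi R k) _ _ iR) => [||x]; last 2 first.
- by move=> m x; rewrite per.
- by rewrite anti; case: (phi k _).
rewrite (integral_antiperiodic R _ _ v (OmegaH_fundamental R) bv (@OmegaH_bounded R)
  (measurable_Im_phi R k) _ _ iI) => [||x]; last 2 first.
- by move=> m x; rewrite per.
- by rewrite anti; case: (phi k _).
by rewrite mulr0.
Qed.

Lemma intH_phi0 (k : ivec) : (forall i, k i = 0) -> intH (@OmegaH R) (phi k) = 2%:R :> C.
Proof.
move=> k0; have p1 (t : pt4 R) : phi k t = 1.
  by rewrite phiE /idot big1 ?mulr0 ?expi0 // => i _; rewrite k0 mul0r.
rewrite /intH.
have -> : (fun x => complex.Re (phi k (embedH x))) = (fun=> 1 : R).
  by apply: funext => x; rewrite p1.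
have -> : (fun x => complex.Im (phi k (embedH x))) = (fun=> 0 : R).
  by apply: funext => x; rewrite p1.
rewrite !Rintegral_cst; try exact: measurable_OmegaH.
have -> : fine (leb3 (@OmegaH R)) = 1 by rewrite (leb3_fundamental R _ (OmegaH_fundamental R)).
by rewrite mulr1 mul0r -[RHS]mulr1.
Qed.

Lemma intH_phiB (n : nat) (k l : ivec) : inHn n k -> inHn n l ->
  intH (@OmegaH R) (phi (fun i => k i - l i)) = if k == l then 2%:R else 0 :> C.
Proof.
move=> /inHnP[kH _] /inHnP[lH _]; case: eqVneq => [<-|kl].
  by apply: intH_phi0 => i; rewrite subrr.
apply: intH_phi_eq0; first exact: inHB.
apply/existsP; apply: contraT; rewrite negb_exists => /forallP h.
case/eqP: kl; apply: funext => i; apply/eqP.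
by have := h i; rewrite negbK subr_eq0.
Qed.

End ComplexIntegral.

Theorem theorem3p15 (R : realType) (n : nat) (hn : (1 <= n)%N)
  (f g : pt4 R -> complex R) :
  in_calH n f -> in_calH n g ->
  ip f g = ip_n n f g /\ ip_n n f g = ip_n_star n f g.
Proof.
move=> [a fE] [b gE].
(* The product of [f] and the conjugate of [g] is a combination of the characters phi_(k-l) over
   pairs of H_n. *)
pose S := [seq (k, l) | k <- Hn_seq n, l <- Hn_seq n].
pose c (p : ivec * ivec) : complex R := a p.1 * conjc (b p.2).
pose d (p : ivec * ivec) : ivec := fun i => p.1 i - p.2 i.
have inS p : p \in S -> inHn n p.1 /\ inHn n p.2.
  by move=> /allpairsP[[k l] /= [kn ln ->]]; rewrite -!mem_Hn.
have fgE t : f t * conjc (g t) = \sum_(p <- S) c p * phi (d p) t.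
  rewrite fE gE rmorph_sum /= big_distrl /= big_allpairs.
  apply: eq_bigr => k _; rewrite mulr_sumr; apply: eq_bigr => l _.
  by rewrite rmorphM /= mulrACA phi_mul_conjc.
have N0 : (4 * n ^ 3)%:R != 0 :> complex R.
  by rewrite pnatr_eq0 muln_eq0 expn_eq0; lia.
(* By orthogonality only the diagonal pairs survive; [delta] is the common value of the inner
   products. *)
pose delta := \sum_(p <- S | p.1 == p.2) c p.
have ipE : ip f g = delta.
  rewrite /ip (_ : (fun t => f t * conjc (g t)) = (fun t => \sum_(p <- S) c p * phi (d p) t)).
    rewrite intH_sum => [|p]; last exact: integrableH_phi.
    rewrite mulr_sumr /delta [RHS]big_mkcond big_seq [RHS]big_seq; apply: eq_bigr => p /inS[pk pl].
    rewrite (intH_phiB _ n) //; case: ifP => _; last by rewrite !mulr0.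
    by rewrite mulrCA mulVf ?mulr1 // pnatr_eq0.
  by apply: funext => t.
have sumE : \sum_(j <- Hn_seq n) f (scale_pt R n j) * conjc (g (scale_pt R n j)) =
    (4 * n ^ 3)%:R * delta.
  under eq_bigr do rewrite fgE.
  rewrite exchange_big /= mulr_sumr [RHS]big_mkcond big_seq [RHS]big_seq.
  apply: eq_bigr => p /inS[pk pl]; rewrite -mulr_sumr sum_phi_Hn //.
  by case: ifP => _; rewrite ?mulr0 // mulrC.
have ipnE : ip_n n f g = delta by rewrite /ip_n sumE mulKf.
split; first by rewrite ipE ipnE.
rewrite /ip_n /ip_n_star; congr (_ * _).
(* At j/4n the product of [f] and the conjugate of [g] depends only on the class of j, so the
   weighted sum over H_n^* reduces to the sum over H_n. *)
rewrite -(sum_Hn_star R n (fun j => f (scale_pt R n j) * conjc (g (scale_pt R n j))) hn).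
  by apply: eq_bigr => j _; rewrite mulrA.
move=> j k jH kH jk; rewrite !fgE big_seq [RHS]big_seq; apply: eq_bigr => p /inS[pk pl].
congr (_ * _); apply: phi_scale_cong => //.
by have /inHnP[h1 _] := pk; have /inHnP[h2 _] := pl; exact: inHB.
Qed.
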